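(* The expansion series $\mathbf{solk}$ is sufficient for Ash's Theorem, but is not sufficient for the strengthened Ash Theorem (both notions of sufficiency being defined in the context). That is: (i) for every finite alphabet $A$, every finite $A$-generated inverse monoid $M$, every finite $A$-generated group $Q$ extending $M$ and every finite graph $\mathcal{E}$ there exists $H\in\mathbf{solk}(Q)$ such that every word labelling of $\mathcal{E}$ that commutes over $H$ admits an $M$-related word labelling that commutes over the free group $F$; (ii) it is not the case that for every finite alphabet $A$, every finite $A$-generated inverse monoid $M$, every finite $A$-generated group $Q$ extending $M$ and every positive integer $n$ there exists $H\in\mathbf{solk}(Q)$ such that, for every finite connected graph $\mathcal{E}$ on at most $n$ vertices, every word labelling of $\mathcal{E}$ that commutes over $H$ admits a word labelling that is both $M$-related and $H$-related to it and that commutes over $F$.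
   Context: For a finite non-empty alphabet $A$, $\tilde A=A\cup A^{-1}$ ($A^{-1}$ a disjoint copy of formal inverses), $\tilde A^*$ is the set of words over $\tilde A$ with involution $(x_1\cdots x_n)^{-1}=x_n^{-1}\cdots x_1^{-1}$, and $F$ is the free group on $A$. An inverse monoid is a monoid in which every $x$ has a unique $x^{-1}$ with $xx^{-1}x=x$, $x^{-1}xx^{-1}=x^{-1}$. An $A$-generated inverse monoid (group) is an inverse monoid (group) $M$ with a (not necessarily injective) map $A\to M$ whose image generates it; $[w]_M$ is the value of $w\in\tilde A^*$ in $M$. An $A$-generated group $G$ extends an $A$-generated inverse monoid $M$ if for all $w\in\tilde A^*$, $[w]_G=1_G$ implies that $[w]_M$ is idempotent. Graphs $\mathcal{E}=(V\cup K;\alpha,\omega,{}^{-1})$ have initial/terminal vertex maps $\alpha,\omega\colon K\to V$ and an involution on the edge set $K$ with $\alpha e=\omega e^{-1}$, $\omega e=\alpha e^{-1}$, $e\ne e^{-1}$ (loops and multiple edges allowed). A word labelling is a map $v\colon K\to\tilde A^*$ with $v(e^{-1})=v(e)^{-1}$; it commutes over an $A$-generated group $G$ if for each closed path $e_1\cdots e_m$ one has $[v(e_1)\cdots v(e_m)]_G=1_G$. Two labellings $u,v$ are $M$-related if $[u(e)]_M=[v(e)]_M$ for every edge $e$. Expansions. An expansion of an $A$-generated group $Q$ is an $A$-generated group $H$ admitting a homomorphism $H\to Q$ respecting the generators from $A$. For a finite $A$-generated group $Q=F/N$ and $m\ge2$ let ${}^{\mathbf{Ab}_m}Q=F/([N,N]N^m)$,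 where $N^m$ is the subgroup generated by the $m$-th powers of elements of $N$; this is a finite $A$-generated expansion of $Q$. For $m_1,\dots,m_t\ge2$ let ${}^{\mathbf{Ab}_{m_t}\cdots\mathbf{Ab}_{m_1}}Q$ be the result of applying successively the expansions ${}^{\mathbf{Ab}_{m_1}}(\cdot)$, ${}^{\mathbf{Ab}_{m_2}}(\cdot)$, …, ${}^{\mathbf{Ab}_{m_t}}(\cdot)$ to $Q$. An expansion series assigns to every finite $A$-generated group $Q$ (for every $A$) a set of finite $A$-generated expansions of $Q$; $\mathbf{solk}(Q)=\{{}^{\mathbf{Ab}_{m_t}\cdots\mathbf{Ab}_{m_1}}Q: t\ge1,\ m_1,\dots,m_t\ge2\}$. An expansion series $\mathbf{exps}$ is sufficient for Ash's Theorem if the statement in (i) holds with $\mathbf{exps}$ in place of $\mathbf{solk}$; it is sufficient for the strengthened Ash Theorem if the statement negated in (ii) holds with $\mathbf{exps}$ in place of $\mathbf{solk}$. *)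

(* Defs.v *)
From HB Require Import structures.
From mathcomp Require Import all_boot.
From mathcomp Require Import boolp classical_sets functions cardinality.

Set Implicit Arguments.
Unset Strict Implicit.
Unset Printing Implicit Defensive.

Local Open Scope quotient_scope.
Local Open Scope classical_set_scope.
Local Open Scope group_scope.

(* The letter (a, false) is a, and (a, true) is its formal inverse. *)
Definition letter (A : Type) : Type := (A * bool)%type.
Definition word (A : Type) : Type := seq (letter A).

Definition linv (A : Type) (x : letter A) : letter A := (x.1, ~~ x.2).
Definition winv (A : Type) (w : word A) : word A := rev (map (@linv A) w).

(* The laws (x^-1)^-1 = x and (x * y)^-1 = y^-1 * x^-1 built into
   starMonoidType hold in every inverse monoid, see inverse_monoid_star. *)
Definition inverse_monoid (M : starMonoidType) : Prop :=
  forall x y : M, (x * y * x = x /\ y * x * y = y) <-> y = x^-1.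

Lemma inverse_monoid_star (M : monoidType) (i : M -> M) :
    (forall x y : M, (x * y * x = x /\ y * x * y = y) <-> y = i x) ->
  involutive i /\ (forall x y, i (x * y) = i y * i x).
Proof.
move=> iP.
have i1 x : x * (i x * x) = x by have [+ _] := (iP x (i x)).2 erefl; rewrite mulgA.
have i2 x : i x * (x * i x) = i x.
  by have [_ +] := (iP x (i x)).2 erefl; rewrite mulgA.
have i1' x z : x * (i x * (x * z)) = x * z by rewrite -[in RHS](i1 x) -!mulgA.
have i2' x z : i x * (x * (i x * z)) = i x * z.
  by rewrite -[in RHS](i2 x) -!mulgA.
have iK : involutive i by move=> x; apply/esym/iP; rewrite -!mulgA i1 i2.
have idK (e z : M) : e * e = e -> e * (e * z) = e * z by rewrite mulgA => ->.
have idI (e f : M) : e * e = e -> f * f = f -> e * (f * (e * f)) = e * f.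
  move=> ee ff; set z := i (e * f).
  have I1 t : e * (f * (z * (e * (f * t)))) = e * (f * t).
    by have := i1' (e * f) t; rewrite -/z -!mulgA.
  have I2 t : z * (e * (f * (z * t))) = z * t.
    by have := i2' (e * f) t; rewrite -/z -!mulgA.
  have zE : f * (z * e) = z.
    apply/iP; rewrite -!mulgA !idK // I2; split=> //.
    by have := i1 (e * f); rewrite -/z -!mulgA.
  have zz : z * z = z by rewrite -[in LHS]zE -!mulgA I2 zE.
  have : z = i z by apply/iP; rewrite !zz.
  by rewrite [in RHS]/z iK => zef; rewrite -[in RHS]zef -zz zef -!mulgA.
have idC (e f : M) : e * e = e -> f * f = f -> e * f = f * e.
  move=> ee ff; have efI := idI _ _ ee ff; have feI := idI _ _ ff ee.
  have -> : f * e = i (e * f).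
    by apply/iP; rewrite -!mulgA !idK // efI feI.
  by apply/iP; rewrite -!mulgA !efI.
split=> // x y; apply/esym/iP; rewrite -!mulgA.
have xx : (i x * x) * (i x * x) = i x * x by rewrite -!mulgA i1.
have yy : (y * i y) * (y * i y) = y * i y by rewrite -!mulgA i1'.
have C t : y * (i y * (i x * (x * t))) = i x * (x * (y * (i y * t))).
  by have := congr1 (fun u => u * t) (idC _ _ yy xx); rewrite -!mulgA.
by rewrite C i1' i1 -C i2' i2.
Qed.

(* This applies to groups too, where it says that S is a subgroup. *)
Definition inverse_submonoid (M : starMonoidType) (S : set M) : Prop :=
  [/\ S 1, forall x y, S x -> S y -> S (x * y) & forall x, S x -> S x^-1].

Definition generates (A : Type) (M : starMonoidType) (g : A -> M) : Prop :=
  smallest (@inverse_submonoid M) (range g) = setT.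

Record invmonoid (A : finType) := InvMonoid {
  im_sort :> starMonoidType;
  im_gen : A -> im_sort;
  im_inverse : inverse_monoid im_sort;
  im_generates : generates im_gen }.

Record agroup (A : finType) := AGroup {
  ag_sort :> groupType;
  ag_gen : A -> ag_sort;
  ag_generates : generates ag_gen }.

Lemma group_inverse_monoid (G : groupType) : inverse_monoid G.
Proof.
move=> x y; split=> [[xyx _]|->]; last by rewrite mulgV mul1g mulVg mul1g.
by apply/esym/mulg1_eq/(mulIg x); rewrite mul1g.
Qed.

Coercion agroup_invmonoid (A : finType) (G : agroup A) : invmonoid A :=
  InvMonoid (@group_inverse_monoid G) (ag_generates G).

Definition letter_value (A : finType) (M : invmonoid A) (x : letter A) : M :=
  if x.2 then (im_gen M x.1)^-1 else im_gen M x.1.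
Definition value (A : finType) (M : invmonoid A) (w : word A) : M :=
  \prod_(x <- w) letter_value M x.

(* The congruence on words generated by x x^-1 = 1, for x a letter. *)
Inductive freely_equal (A : Type) : word A -> word A -> Prop :=
| freely_refl u : freely_equal u u
| freely_sym u v : freely_equal u v -> freely_equal v u
| freely_trans u v w :
    freely_equal u v -> freely_equal v w -> freely_equal u w
| freely_cancel u x v : freely_equal (u ++ x :: linv x :: v) (u ++ v).

Section FreeGroup.
Variable A : finType.
Implicit Types (u v w : word A) (x : letter A).

Definition freely_equalb : rel (word A) := fun u v => `[< freely_equal u v >].

Lemma freely_equalb_refl : reflexive freely_equalb.
Proof. by move=> u; apply/asboolP/freely_refl. Qed.

Lemma freely_equalb_sym : symmetric freely_equalb.
Proof. by move=> u v; apply/asboolP/asboolP; apply: freely_sym. Qed.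

Lemma freely_equalb_trans : transitive freely_equalb.
Proof.
by move=> v u w /asboolP uv /asboolP vw; apply/asboolP/(freely_trans uv).
Qed.

Canonical freely_equal_equiv :=
  EquivRel freely_equalb
    freely_equalb_refl freely_equalb_sym freely_equalb_trans.

Definition free_group_type := {eq_quot freely_equal_equiv}.

HB.instance Definition _ := Choice.on free_group_type.
HB.instance Definition _ : EqQuotient (word A) freely_equal_equiv free_group_type
  := EqQuotient.on free_group_type.

Definition fword (w : word A) : free_group_type := \pi w.

Lemma fwordP u v : fword u = fword v <-> freely_equal u v.
Proof.
by split=> [/eqquotP/asboolP|uv]; [|apply/eqquotP/asboolP].
Qed.

Lemma fword_repr (g : free_group_type) : fword (repr g) = g.
Proof. exact: reprK. Qed.

Lemma freely_catl w u v : freely_equal u v -> freely_equal (w ++ u) (w ++ v).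
Proof.
elim=> [?|? ? _|? ? ? _ IH1 _ IH2|u1 x v1].
- exact: freely_refl.
- exact: freely_sym.
- exact: freely_trans IH1 IH2.
- by rewrite !catA; apply: freely_cancel.
Qed.

Lemma freely_catr w u v : freely_equal u v -> freely_equal (u ++ w) (v ++ w).
Proof.
elim=> [?|? ? _|? ? ? _ IH1 _ IH2|u1 x v1].
- exact: freely_refl.
- exact: freely_sym.
- exact: freely_trans IH1 IH2.
- by rewrite -!catA; apply: freely_cancel.
Qed.

Lemma linvK : involutive (@linv A).
Proof. by case=> a b; rewrite /linv /= negbK. Qed.

Lemma winv_cons x w : winv (x :: w) = winv w ++ [:: linv x].
Proof. by rewrite /winv /= rev_cons cats1. Qed.

Lemma winv_cat u v : winv (u ++ v) = winv v ++ winv u.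
Proof. by rewrite /winv map_cat rev_cat. Qed.

Lemma freely_winv u v : freely_equal u v -> freely_equal (winv u) (winv v).
Proof.
elim=> [?|? ? _|? ? ? _ IH1 _ IH2|u1 x v1].
- exact: freely_refl.
- exact: freely_sym.
- exact: freely_trans IH1 IH2.
- rewrite !winv_cat !winv_cons linvK -!catA /=; exact: (freely_cancel _ (x)).
Qed.

Lemma freely_winvl w : freely_equal (winv w ++ w) [::].
Proof.
elim: w => [|x w IHw]; first exact: freely_refl.
rewrite winv_cons -catA /=; apply: freely_trans IHw.
by have := freely_cancel (winv w) (linv x) w; rewrite linvK.
Qed.

Lemma winvK : involutive (@winv A).
Proof.
elim=> // x w IHw; rewrite winv_cons winv_cat IHw /=.
by rewrite /winv /= /rev /= linvK.
Qed.

Definition free_one : free_group_type := fword [::].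
Definition free_mul (g h : free_group_type) := fword (repr g ++ repr h).
Definition free_inv (g : free_group_type) := fword (winv (repr g)).

Lemma freely_repr w : freely_equal (repr (fword w)) w.
Proof. by apply/fwordP; rewrite fword_repr. Qed.

Lemma fword_cat u v : fword (u ++ v) = free_mul (fword u) (fword v).
Proof.
apply/fwordP/(freely_trans (v := u ++ repr (fword v))).
  exact/freely_catl/freely_sym/freely_repr.
exact/freely_catr/freely_sym/freely_repr.
Qed.

Lemma fword_winv w : fword (winv w) = free_inv (fword w).
Proof. exact/fwordP/freely_winv/freely_sym/freely_repr. Qed.

Lemma free_mulA : associative free_mul.
Proof.
move=> x y z; rewrite -(fword_repr x) -(fword_repr y) -(fword_repr z).
by rewrite -!fword_cat catA.
Qed.

Lemma free_mul1 : left_id free_one free_mul.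
Proof. by move=> x; rewrite -(fword_repr x) -fword_cat. Qed.

Lemma free_mulr1 : right_id free_one free_mul.
Proof. by move=> x; rewrite -(fword_repr x) -fword_cat cats0. Qed.

Lemma free_mulV : left_inverse free_one free_inv free_mul.
Proof.
move=> x; rewrite -(fword_repr x) -fword_winv -fword_cat.
exact/fwordP/freely_winvl.
Qed.

Lemma free_mulrV : right_inverse free_one free_inv free_mul.
Proof.
move=> x; rewrite -(fword_repr x) -fword_winv -fword_cat.
by apply/fwordP; rewrite -{1}(winvK (repr x)); apply: freely_winvl.
Qed.

HB.instance Definition _ := isGroup.Build free_group_type
  free_mulA free_mul1 free_mulr1 free_mulV free_mulrV.

Definition free_gen (a : A) : free_group_type := fword [:: (a, false)].

Lemma free_generates : generates free_gen.
Proof.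
rewrite /generates -subTset => g _ S [[S1 SM SV] genS]; rewrite -(fword_repr g).
elim: (repr g) => // x w IHw; rewrite -cat1s fword_cat; apply: SM => //.
case: x => a [|]; last by apply: genS; exists a.
have -> : fword [:: (a, true)] = (free_gen a)^-1
  by exact: (fword_winv [:: (a, false)]).
by apply/SV/genS; exists a.
Qed.

Definition free_group : agroup A := AGroup free_generates.

End FreeGroup.

Section Value.
Variable A : finType.

Lemma value_nil (M : invmonoid A) : value M [::] = 1.
Proof. exact: big_nil. Qed.

Lemma value_cat (M : invmonoid A) u v : value M (u ++ v) = value M u * value M v.
Proof. exact: big_cat. Qed.

Lemma value_seq1 (M : invmonoid A) x : value M [:: x] = letter_value M x.
Proof. exact: big_seq1. Qed.

Lemma value_freely (G : agroup A) u v :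
  freely_equal u v -> value G u = value G v.
Proof.
elim=> // [? ? ? _ -> _ -> //|u1 x v1].
rewrite !value_cat -(cat1s x) -(cat1s (linv x)) !value_cat !value_seq1.
congr (_ * _); rewrite mulgA -[RHS](mul1g (value G v1)); congr (_ * _).
by case: x => a [|]; rewrite /letter_value /= ?mulVg ?mulgV.
Qed.

Lemma value_free w : value (free_group A) w = fword w.
Proof.
elim: w => [|x w IHw]; first by rewrite value_nil.
rewrite -cat1s value_cat IHw fword_cat value_seq1; congr (free_mul _ _).
by case: x => a [|] //; rewrite /letter_value /= -[LHS]fword_winv.
Qed.

Lemma value_gen (M : invmonoid A) (x : M) : exists w, value M w = x.
Proof.
suff : [set value M w | w in [set: word A]] x by case=> w _ <-; exists w.
have : smallest (@inverse_submonoid M) (range (im_gen M)) x.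
  by rewrite (im_generates M).
apply: smallest_sub.
  split; first by exists [::] => //; rewrite value_nil.
  - by move=> _ _ [u _ <-] [v _ <-]; exists (u ++ v); rewrite // value_cat.
  - move=> _ [u _ <-]; exists (winv u) => //.
    elim: u => [|y u IHu]; first by rewrite value_nil invg1.
    rewrite winv_cons -(cat1s y) !value_cat invgM IHu !value_seq1.
    by case: y => a [|]; rewrite /letter_value /= ?invgK.
by move=> _ [a _ <-]; exists [:: (a, false)]; rewrite // value_seq1.
Qed.

End Value.

Section FreeLift.
Variables (A : finType) (G : agroup A).

Definition free_lift (g : free_group A) : G := value G (repr (g : free_group_type A)).

Lemma free_liftE w : free_lift (fword w) = value G w.
Proof. exact/value_freely/freely_repr. Qed.

Lemma free_lift_morph : {morph free_lift : x y / x * y}.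
Proof.
move=> x y; rewrite -(fword_repr x) -(fword_repr y) -[_ * _]fword_cat.
by rewrite !free_liftE value_cat.
Qed.

HB.instance Definition _ :=
  isMultiplicative.Build (free_group A) G free_lift free_lift_morph.

Lemma free_lift_gen a : free_lift (ag_gen (free_group A) a) = ag_gen G a.
Proof. by rewrite [LHS]free_liftE value_seq1. Qed.

End FreeLift.

Definition normal_set (G : groupType) (N : set G) : Prop :=
  inverse_submonoid N /\ forall x y, N x -> N (x ^ y).

Record normal_subgroup (G : groupType) := NormalSubgroup {
  ns_set :> set G;
  ns_normal : normal_set ns_set }.

Section Quotient.
Variables (G : groupType) (N : normal_subgroup G).

Lemma ns1 : ns_set N 1. Proof. by have [[]] := ns_normal N. Qed.
Lemma nsM x y : ns_set N x -> ns_set N y -> ns_set N (x * y).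
Proof. by have [[_ + _] _] := ns_normal N; apply. Qed.
Lemma nsV x : ns_set N x -> ns_set N x^-1.
Proof. by have [[_ _ +] _] := ns_normal N; apply. Qed.
Lemma nsJ x y : ns_set N x -> ns_set N (x ^ y).
Proof. by have [_ +] := ns_normal N; apply. Qed.

Definition same_coset : rel G := fun x y => `[< ns_set N (x^-1 * y) >].

Lemma same_coset_refl : reflexive same_coset.
Proof. by move=> x; apply/asboolP; rewrite mulVg; apply: ns1. Qed.

Lemma same_coset_sym : symmetric same_coset.
Proof.
by move=> x y; apply/asboolP/asboolP => /nsV; rewrite invgM invgK.
Qed.

Lemma same_coset_trans : transitive same_coset.
Proof.
move=> y x z /asboolP xy /asboolP yz; apply/asboolP.
by have := nsM xy yz; rewrite -mulgA mulVKg.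
Qed.

Canonical same_coset_equiv :=
  EquivRel same_coset same_coset_refl same_coset_sym same_coset_trans.

Definition quotient_group := {eq_quot same_coset_equiv}.

HB.instance Definition _ := Choice.on quotient_group.
HB.instance Definition _ : EqQuotient G same_coset_equiv quotient_group
  := EqQuotient.on quotient_group.

Definition qcoset (x : G) : quotient_group := \pi x.

Lemma qcosetP x y : qcoset x = qcoset y <-> ns_set N (x^-1 * y).
Proof. by split=> [/eqquotP/asboolP|uv]; [|apply/eqquotP/asboolP]. Qed.

Lemma qcoset_repr (g : quotient_group) : qcoset (repr g) = g.
Proof. exact: reprK. Qed.

Definition quo_one := qcoset 1.
Definition quo_mul (g h : quotient_group) := qcoset (repr g * repr h).
Definition quo_inv (g : quotient_group) := qcoset (repr g)^-1.

Lemma qcosetM x y : qcoset (x * y) = quo_mul (qcoset x) (qcoset y).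
Proof.
set x' := repr (qcoset x); set y' := repr (qcoset y).
have xx : ns_set N (x^-1 * x') by apply/qcosetP; rewrite qcoset_repr.
have yy : ns_set N (y^-1 * y') by apply/qcosetP; rewrite qcoset_repr.
apply/qcosetP; have := nsM yy (nsJ y' xx).
by rewrite conjgE invgM -!mulgA !mulVKg.
Qed.

Lemma qcosetV x : qcoset x^-1 = quo_inv (qcoset x).
Proof.
set x' := repr (qcoset x).
have xx : ns_set N (x^-1 * x') by apply/qcosetP; rewrite qcoset_repr.
apply/qcosetP; have := nsJ (x^-1) (nsV xx).
rewrite conjgE invgM !invgK -!mulgA mulgV mulg1 => /nsV.
by rewrite invgM invgK => /nsV; rewrite invgM invgK.
Qed.

Lemma quo_mulA : associative quo_mul.
Proof.
move=> x y z; rewrite -(qcoset_repr x) -(qcoset_repr y) -(qcoset_repr z).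
by rewrite -!qcosetM mulgA.
Qed.

Lemma quo_mul1 : left_id quo_one quo_mul.
Proof. by move=> x; rewrite -(qcoset_repr x) -qcosetM mul1g. Qed.

Lemma quo_mulr1 : right_id quo_one quo_mul.
Proof. by move=> x; rewrite -(qcoset_repr x) -qcosetM mulg1. Qed.

Lemma quo_mulV : left_inverse quo_one quo_inv quo_mul.
Proof. by move=> x; rewrite -(qcoset_repr x) -qcosetV -qcosetM mulVg. Qed.

Lemma quo_mulrV : right_inverse quo_one quo_inv quo_mul.
Proof. by move=> x; rewrite -(qcoset_repr x) -qcosetV -qcosetM mulgV. Qed.

HB.instance Definition _ := isGroup.Build quotient_group
  quo_mulA quo_mul1 quo_mulr1 quo_mulV quo_mulrV.

HB.instance Definition _ :=
  isMultiplicative.Build G quotient_group qcoset qcosetM.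

End Quotient.

Lemma quotient_generates (A : finType) (G : agroup A) (N : normal_subgroup G) :
  generates (fun a => qcoset N (ag_gen G a)).
Proof.
rewrite /generates -subTset => g _ S [[S1 SM SV] genS]; rewrite -(qcoset_repr g).
have : smallest (@inverse_submonoid G) (range (ag_gen G)) (repr g).
  by rewrite (ag_generates G).
apply: (smallest_sub (X := [set x | S (qcoset N x)])).
  split=> [|x y Sx Sy|x Sx] /=; first exact: S1.
    by rewrite qcosetM; apply: SM.
  by rewrite qcosetV; apply: SV.
by move=> _ [a _ <-]; apply: genS; exists a.
Qed.

Definition quotient_agroup (A : finType) (G : agroup A) (N : normal_subgroup G)
  : agroup A := AGroup (quotient_generates N).

Section Ab.
Variables (G : groupType).

Definition subgroup_gen (X : set G) : set G := smallest (@inverse_submonoid G) X.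

Lemma subgroup_gen_sub X : X `<=` subgroup_gen X.
Proof. exact: sub_smallest. Qed.

Lemma subgroup_gen_closed X : inverse_submonoid (subgroup_gen X).
Proof.
split=> [S [[]//]|x y Xx Xy S [SS XS]|x Xx S [SS XS]]; have [S1 SM SV] := SS.
  by apply: SM; [apply: Xx|apply: Xy].
by apply: SV; apply: Xx.
Qed.

Lemma subgroup_gen1 X : subgroup_gen X 1.
Proof. by have [] := subgroup_gen_closed X. Qed.

Lemma subgroup_gen_normal X :
  (forall x y, X x -> X (x ^ y)) -> normal_set (subgroup_gen X).
Proof.
move=> XJ; split=> [|x y]; first exact: subgroup_gen_closed.
have [g1 gM gV] := subgroup_gen_closed X.
apply: (smallest_sub (X := [set x | subgroup_gen X (x ^ y)])).
  split=> [|u v ? ?|u ?] /=; rewrite ?conj1g ?conjMg ?conjVg //.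
    exact: gM.
  exact: gV.
by move=> u Xu /=; apply: subgroup_gen_sub; apply: XJ.
Qed.

Definition commutators (N : set G) : set G := [set [~ x, y] | x in N & y in N].
Definition powers (N : set G) (m : nat) : set G := [set x ^+ m | x in N].

(* [N, N] N^m *)
Definition Ab_set (N : set G) (m : nat) : set G :=
  [set x * y | x in subgroup_gen (commutators N) & y in subgroup_gen (powers N m)].

Lemma Ab_normal (N : normal_subgroup G) (m : nat) : normal_set (Ab_set N m).
Proof.
have [[c1 cM cV] cJ] : normal_set (subgroup_gen (commutators N)).
  apply: subgroup_gen_normal => _ z [x Nx [y Ny <-]].
  by rewrite conjRg; exists (x ^ z); [exact: nsJ|exists (y ^ z) => //; exact: nsJ].
have [[p1 pM pV] pJ] : normal_set (subgroup_gen (powers N m)).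
  apply: subgroup_gen_normal => _ z [x Nx <-].
  by rewrite conjXg; exists (x ^ z) => //; exact: nsJ.
split; first split.
- by exists 1 => //; exists 1; rewrite ?mulg1.
- move=> _ _ [x Cx [y Py <-]] [x' Cx' [y' Py' <-]].
  exists (x * (x' ^ y^-1)); first by apply: cM => //; apply: cJ.
  exists (y * y'); first exact: pM.
  by rewrite conjgE invgK -!mulgA mulKg.
- move=> _ [x Cx [y Py <-]]; exists (x^-1 ^ y); first by apply: cJ; apply: cV.
  exists (y^-1); first exact: pV.
  by rewrite conjgE invgM -!mulgA mulgV mulg1.
- move=> _ z [x Cx [y Py <-]]; exists (x ^ z); first exact: cJ.
  by exists (y ^ z); [exact: pJ|rewrite conjMg].
Qed.

End Ab.

Definition Ab_subgroup (G : groupType) (N : normal_subgroup G) (m : nat) :=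
  NormalSubgroup (Ab_normal N m).

Lemma kernel_normal (G H : groupType) (f : {multiplicative G -> H}) :
  normal_set (f @^-1` [set 1]).
Proof.
have f1 : f 1 = 1 by apply: (mulgI (f 1)); rewrite -gmulfM !mulg1.
have fV x : f x^-1 = (f x)^-1 by apply: (mulgI (f x)); rewrite -gmulfM !mulgV.
split; first split=> [|x y|x] //=.
- by rewrite gmulfM => -> ->; rewrite mulg1.
- by rewrite fV => ->; rewrite invg1.
- by move=> x y /= fx; rewrite !gmulfM fV fx mul1g mulVg.
Qed.

Definition kernel (G H : groupType) (f : {multiplicative G -> H}) :=
  NormalSubgroup (kernel_normal f).

(* The kernel of free_lift Q is the N of Q = F/N. *)
Definition Ab (A : finType) (m : nat) (Q : agroup A) : agroup A :=
  quotient_agroup (G := free_group A) (Ab_subgroup (kernel (free_lift Q)) m).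

Definition is_finite (T : Type) : Prop := finite_set [set: T].

(* H is an expansion of Q. *)
Definition expansion (A : finType) (Q H : agroup A) : Prop :=
  exists f : {multiplicative H -> Q}, forall a, f (ag_gen H a) = ag_gen Q a.

Lemma expansion_refl (A : finType) (Q : agroup A) : expansion Q Q.
Proof. by exists idfun. Qed.

Lemma expansion_trans (A : finType) (Q R S : agroup A) :
  expansion Q R -> expansion R S -> expansion Q S.
Proof.
by move=> [f fg] [g gg]; exists (f \o g) => a /=; rewrite gg fg.
Qed.

(* Products of powers of the entries of ss, with exponents below m. *)
Fixpoint power_products (G : groupType) (m : nat) (ss : seq G) : set G :=
  if ss is s :: ss' then
    [set s ^+ i * b | i in `I_m & b in power_products m ss']
  else [set 1].

Lemma power_products_finite (G : groupType) m (ss : seq G) :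
  finite_set (power_products m ss).
Proof.
elim: ss => [|s ss IHss] /=; first exact: finite_set1.
exact/finite_image2/IHss/finite_II.
Qed.

Lemma power_products1 (G : groupType) m (ss : seq G) : (0 < m)%N ->
  power_products m ss 1.
Proof.
move=> m0; elim: ss => //= s ss IHss.
by exists 0%N => //; exists 1; rewrite ?mulg1.
Qed.

Lemma power_productsM (G : groupType) m (ss : seq G) :
    (0 < m)%N -> (forall x, x \in ss -> x ^+ m = 1) ->
    (forall x y, x \in ss -> y \in ss -> x * y = y * x) ->
  forall x b, x \in ss -> power_products m ss b -> power_products m ss (x * b).
Proof.
move=> m0; elim: ss => //= s ss IHss expm comm x b.
rewrite inE => xs [i im [c cP <-]].
have [-> {x xs}|xNs] := eqVneq x s.
  rewrite mulgA -expgS; case: (ltnP i.+1 m) => [im'|mi].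
    by exists i.+1 => //; exists c.
  have -> : i.+1 = m by apply/eqP; rewrite eqn_leq mi andbT.
  by rewrite expm ?mem_head //; exists 0%N => //; exists c.
have {}xs : x \in ss by move: xs; rewrite (negPf xNs).
exists i => //; exists (x * c).
  apply: IHss => // [y ys|y z ys zs]; first by apply: expm; rewrite inE ys orbT.
  by apply: comm; rewrite inE ?ys ?zs orbT.
rewrite !mulgA; congr (_ * _).
by apply/esym/commuteX/comm; rewrite inE ?xs ?eqxx ?orbT.
Qed.

Section AbTheory.
Variables (A : finType) (m : nat) (Q : agroup A).
Let K := kernel (free_lift Q).
Let N := Ab_subgroup K m.

Definition Ab_proj (x : Ab m Q) : Q :=
  free_lift Q (repr (x : quotient_group N)).

Lemma Ab_proj_coset x : Ab_proj (qcoset N x) = free_lift Q x.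
Proof.
have KC : inverse_submonoid K by have [] := ns_normal K.
have [K0 KM KV] := KC.
have KN z : ns_set N z -> ns_set K z.
  move=> [y Cy [t Pt <-]]; apply: (KM).
    apply: (smallest_sub KC _ Cy) => _ [u Ku [v Kv <-]].
    by apply: (KM _ _ (KV _ Ku)); apply: (nsJ (N := K)).
  apply: (smallest_sub KC _ Pt) => _ [u Ku <-].
  by elim: {Pt}m => [|k IHk]; rewrite ?expg0 // expgS; apply: KM.
have xr : ns_set K (x^-1 * repr (qcoset N x)).
  by apply/KN/qcosetP; rewrite qcoset_repr.
rewrite /Ab_proj -[in LHS](mulVKg x (repr _)) gmulfM.
by rewrite [X in _ * X]xr mulg1.
Qed.

Lemma Ab_proj_morph : {morph Ab_proj : x y / x * y}.
Proof.
move=> x y; rewrite -(qcoset_repr x) -(qcoset_repr y) -[_ * _]qcosetM.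
by rewrite !Ab_proj_coset gmulfM.
Qed.

HB.instance Definition _ :=
  isMultiplicative.Build (Ab m Q) Q Ab_proj Ab_proj_morph.

Lemma Ab_expansion : expansion Q (Ab m Q).
Proof. by exists Ab_proj => a; rewrite [LHS]Ab_proj_coset free_lift_gen. Qed.

Lemma Ab_ker_comm x y : Ab_proj x = 1 -> Ab_proj y = 1 -> x * y = y * x.
Proof.
move=> Kx Ky; rewrite -(qcoset_repr x) -(qcoset_repr y) -[LHS]qcosetM -[RHS]qcosetM.
apply/qcosetP; rewrite invgM -!mulgA.
exists [~ repr y, repr x]; last by exists 1; rewrite ?mulg1 //; apply: subgroup_gen1.
by apply: subgroup_gen_sub; exists (repr y) => //; exists (repr x).
Qed.

Lemma Ab_ker_exp x : Ab_proj x = 1 -> x ^+ m = 1.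
Proof.
move=> Kx; rewrite -(qcoset_repr x).
have -> k (z : free_group A) : (qcoset N z : Ab m Q) ^+ k = qcoset N (z ^+ k).
  by elim: k => // k IHk; rewrite !expgS IHk [RHS]qcosetM.
apply/esym/qcosetP; rewrite invg1 mul1g; exists 1; first exact: subgroup_gen1.
exists (repr x ^+ m); last by rewrite mul1g.
by apply: subgroup_gen_sub; exists (repr x).
Qed.

Lemma Ab_finite : (0 < m)%N -> is_finite Q -> is_finite (Ab m Q).
Proof.
move=> m0 Qfin; have /finite_seqP[qs qsE] := Qfin.
have qsP y : y \in qs by have : [set: Q] y by []; rewrite qsE.
have /choice[t tK] : forall y : Q, exists x : Ab m Q, Ab_proj x = y.
  move=> y; have [w <-] := value_gen (M := Q) y; exists (qcoset N (fword w)).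
  by rewrite Ab_proj_coset free_liftE.
have p1 : Ab_proj 1 = 1.
  by apply: (mulgI (Ab_proj 1)); rewrite -gmulfM !mulg1.
have pV x : Ab_proj x^-1 = (Ab_proj x)^-1.
  by apply: (mulgI (Ab_proj x)); rewrite -gmulfM !mulgV.
pose s (x : letter A) (y : Q) : Ab m Q :=
  let l := letter_value (Ab m Q) x in (t (Ab_proj l * y))^-1 * (l * t y).
pose ss := [seq s x y | x <- enum {: letter A}, y <- qs].
have ssK x : x \in ss -> Ab_proj x = 1.
  by case/allpairsP=> -[l y] [_ _ ->] /=; rewrite !Ab_proj_morph pV !tK mulVg.
have ssM := @power_productsM _ m ss m0.
have {}ssM : forall x b, x \in ss ->
    power_products m ss b -> power_products m ss (x * b).
  by apply: ssM => [x /ssK/Ab_ker_exp|x y /ssK + /ssK]; last exact: Ab_ker_comm.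
have fin : finite_set
    [set t y * b * (t 1)^-1 | y in [set: Q] & b in power_products m ss].
  exact/finite_image2/power_products_finite.
apply: sub_finite_set fin => x _; have [w <-] := value_gen (M := Ab m Q) x.
suff [y [b [bP e]]] : exists y b,
    power_products m ss b /\ value (Ab m Q) w * t 1 = t y * b.
  by exists y => //; exists b => //; rewrite /= -e mulgK.
elim: w {x} => [|x w [y [b [bP e]]]].
  exists 1, 1; rewrite value_nil mul1g mulg1; split=> //.
  exact: power_products1.
exists (Ab_proj (letter_value (Ab m Q) x) * y), (s x y * b); split.
  by apply: ssM => //; apply/allpairsP; exists (x, y); rewrite mem_enum.
by rewrite -cat1s value_cat value_seq1 -mulgA e /s !mulgA mulgV mul1g.
Qed.

End AbTheory.

(* es_set Q is constrained only for finite Q; its values elsewhere are never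
   used. *)
Record expansion_series := ExpansionSeries {
  es_set :> forall A : finType, agroup A -> agroup A -> Prop;
  es_expansion : forall (A : finType) (Q H : agroup A),
    (0 < #|A|)%N -> is_finite Q -> es_set Q H ->
    is_finite H /\ expansion Q H }.

(* The head of ms is applied first. *)
Definition iterated_Ab (A : finType) (ms : seq nat) (Q : agroup A) : agroup A :=
  foldl (fun R m => Ab m R) Q ms.

Definition solk_set (A : finType) (Q H : agroup A) : Prop :=
  exists ms : seq nat,
     [/\ (0 < size ms)%N, all (leq 2) ms & H = iterated_Ab ms Q].

Lemma solk_expansion (A : finType) (Q H : agroup A) :
  (0 < #|A|)%N -> is_finite Q -> solk_set Q H -> is_finite H /\ expansion Q H.
Proof.
move=> _ Qfin [ms [_ ms2 ->]].
elim/last_ind: ms ms2 => [|ms m IHms]; first by split=> //; apply: expansion_refl.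
rewrite all_rcons /iterated_Ab foldl_rcons => /andP[m2 /IHms[Rfin QR]].
split; first by apply: Ab_finite => //; apply: ltnW.
exact/(expansion_trans QR)/Ab_expansion.
Qed.

Definition solk : expansion_series := ExpansionSeries solk_expansion.

Definition extends (A : finType) (G : agroup A) (M : invmonoid A) : Prop :=
  forall w : word A, value G w = 1 -> value M w * value M w = value M w.

Record graph := Graph {
  vertex : finType;
  edge : finType;
  source : edge -> vertex;
  target : edge -> vertex;
  einv : edge -> edge;
  einvK : involutive einv;
  source_target : forall e, source e = target (einv e);
  target_source : forall e, target e = source (einv e);
  einv_neq : forall e, e <> einv e }.

(* Edge sets are closed under einv, so directed reachability is symmetric. *)
Definition connected (E : graph) : Prop :=
  forall x y : vertex E,
    connect (fun x y => [exists e : edge E, (source e == x) && (target e == y)])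
      x y.

(* cycle also accepts the empty sequence, on which commutation is trivial. *)
Definition closed_path (E : graph) (p : seq (edge E)) : bool :=
  cycle (fun e f => target e == source f) p.

Record labelling (A : finType) (E : graph) := Labelling {
  label :> edge E -> word A;
  label_inv : forall e, label (einv e) = winv (label e) }.

Definition commutes (A : finType) (E : graph) (G : agroup A)
    (v : labelling A E) : Prop :=
  forall p : seq (edge E), closed_path p -> value G (flatten (map v p)) = 1.

Definition related (A : finType) (E : graph) (M : invmonoid A)
    (u v : labelling A E) : Prop :=
  forall e : edge E, value M (u e) = value M (v e).

Definition sufficient_for_Ash (exps : expansion_series) : Prop :=
  forall A : finType, (0 < #|A|)%N ->
  forall M : invmonoid A, is_finite M ->
  forall Q : agroup A, is_finite Q -> extends Q M ->
  forall E : graph,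
  exists H : agroup A, exps A Q H /\
    forall v : labelling A E, commutes H v ->
      exists u : labelling A E, related M u v /\ commutes (free_group A) u.

Definition sufficient_for_strengthened_Ash (exps : expansion_series) : Prop :=
  forall A : finType, (0 < #|A|)%N ->
  forall M : invmonoid A, is_finite M ->
  forall Q : agroup A, is_finite Q -> extends Q M ->
  forall n : nat, (0 < n)%N ->
  exists H : agroup A, exps A Q H /\
    forall E : graph, connected E -> (#|vertex E| <= n)%N ->
    forall v : labelling A E, commutes H v ->
      exists u : labelling A E,
        [/\ related M u v, related H u v & commutes (free_group A) u].

(* Main.v *)
(* (i) Reading a word w from 1 draws a path in the Cayley graph of Q.  As Q
   extends M, the value of w in M is unchanged when w is replaced by
   w w^-1 w', where w' labels a path with the same end inside the path of w;
   it therefore suffices to find such w' that commute over F.  If [w] = 1 in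
   Ab_2 Q, then the path of w traverses every edge of the Cayley graph of Q an
   even number of times, so if w = w_1 ... w_n the edges traversed oddly often
   by w_1 join the ends of w_1 and are all shared with w_2 ... w_n.  Following
   them as long as they stay in w_n gives a cut of the n-gon into two shorter
   polygons, and n - 1 levels of Ab_2 lift a closed n-gon to F.  A general
   graph is lifted one edge at a time: removing an edge from x to y, the rest
   lifts to the Cayley tree of F, and the geodesic from x to y in the tree,
   subdivided at the projections of all vertices, together with the removed
   edge is again a polygon.

   (ii) Let Q be trivial, A = {a, b} and M the semilattice of subsets of A.
   In the result of Ab_{m_t} ... Ab_{m_1} put n = m_1 ... m_{t-1}.  The
   elements a^n and b^n lie in the last kernel, so they commute, which labels a
   4-cycle with a^n, b^n, a^-n, b^-n.  The exponent sum of a word with value 1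
   is divisible by n m_t, so related labels have the same content and nonzero
   exponent sums, and a^i b^j a^k b^l with i, j nonzero is not 1 in F. *)
Require Import Defs.
From HB Require Import structures.
From mathcomp Require Import all_boot ssralg ssrint intdiv zify ring.
From mathcomp Require Import boolp classical_sets cardinality.

Set Implicit Arguments.
Unset Strict Implicit.
Unset Printing Implicit Defensive.

Import GRing.Theory.

Local Open Scope group_scope.

(** * Values of words in groups and in their expansions *)

Section GroupValue.
Variable A : finType.
Implicit Types (G : agroup A) (x : letter A) (u v w : word A).

(* [value] and [letter_value] typed in the group itself rather than in the
   inverse monoid it coerces to, so that group lemmas rewrite. *)
Definition gval G w : G := value G w.
Definition glet G x : G := letter_value G x.

Lemma gval_nil G : gval G [::] = 1.
Proof. exact: value_nil. Qed.

Lemma gval_cat G u v : gval G (u ++ v) = gval G u * gval G v.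
Proof. exact: value_cat. Qed.

Lemma gval_cons G x w : gval G (x :: w) = glet G x * gval G w.
Proof. by rewrite -cat1s gval_cat; congr (_ * _); apply: value_seq1. Qed.

Lemma glet_linv G x : glet G (linv x) = (glet G x)^-1.
Proof. by case: x => a [|] //=; rewrite /glet /letter_value /= invgK. Qed.

Lemma gval_winv G w : gval G (winv w) = (gval G w)^-1.
Proof.
elim: w => [|x w IHw]; first by rewrite gval_nil invg1.
by rewrite winv_cons gval_cat !gval_cons gval_nil mulg1 glet_linv IHw invgM.
Qed.

Lemma gval_freely G u v : freely_equal u v -> gval G u = gval G v.
Proof. exact: value_freely. Qed.

Lemma freely_gval u v :
  gval (free_group A) u = gval (free_group A) v <-> freely_equal u v.
Proof. by rewrite /gval !value_free fwordP. Qed.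

End GroupValue.

Section Expansion.
Variables (A : finType) (m : nat) (Q : agroup A).
Implicit Types (u v w : word A).

Lemma gval_Ab w : gval (Ab m Q) w =
  qcoset (Ab_subgroup (kernel (free_lift Q)) m) (fword w).
Proof.
elim: w => [|x w IHw]; first by rewrite gval_nil.
rewrite gval_cons IHw -cat1s fword_cat [RHS]qcosetM; congr (_ * _).
case: x => a [|] //; rewrite /glet /letter_value /= -[LHS]qcosetV.
by congr qcoset; rewrite -[LHS](fword_winv [:: (a, false)]).
Qed.

Lemma Ab_gval1 w : gval (Ab m Q) w = 1 ->
  Ab_set (kernel (free_lift Q)) m (fword w).
Proof.
by rewrite gval_Ab => /esym/qcosetP; rewrite invg1 mul1g.
Qed.

Lemma gval_Ab_proj w : Ab_proj (gval (Ab m Q) w) = gval Q w.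
Proof. by rewrite gval_Ab Ab_proj_coset free_liftE. Qed.

Lemma gval_Ab_eq u v :
  gval (Ab m Q) u = gval (Ab m Q) v -> gval Q u = gval Q v.
Proof. by move=> uv; rewrite -!gval_Ab_proj uv. Qed.

Lemma gval_Ab_eq1 u : gval (Ab m Q) u = 1 -> gval Q u = 1.
Proof. by move=> u1; rewrite (gval_Ab_eq (v := [::])) ?gval_nil. Qed.

End Expansion.

(** * Paths in Cayley graphs and words running inside them *)

Section Trail.
Variables (A : finType) (G : agroup A).
Implicit Types (g h : G) (x : letter A) (u v w d : word A).

(* The positively oriented edge (h, a) : h -> h * a of the Cayley graph of G
   that is traversed when the letter x is read at g. *)
Definition medge g x : G * A := (if x.2 then g * glet G x else g, x.1).

Fixpoint trail g w : seq (G * A) :=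
  if w is x :: w' then medge g x :: trail (g * glet G x) w' else [::].

Lemma trail_cat g u v : trail g (u ++ v) = trail g u ++ trail (g * gval G u) v.
Proof.
elim: u g => [|x u IHu] g /=; first by rewrite gval_nil mulg1.
by rewrite IHu gval_cons mulgA.
Qed.

Lemma size_trail g w : size (trail g w) = size w.
Proof. by elim: w g => //= x w IHw g; rewrite IHw. Qed.

Lemma trail_mulg h g w :
  trail (h * g) w = [seq (h * e.1, e.2) | e <- trail g w].
Proof.
elim: w g => //= x w IHw g; rewrite -mulgA IHw /medge /= -mulgA.
by case: x => a [|].
Qed.

Lemma medge_linv g x : medge (g * glet G x) (linv x) = medge g x.
Proof.
rewrite /medge glet_linv mulgK.
by case: x => a [|].
Qed.

Lemma trail_winv g w : trail (g * gval G w) (winv w) = rev (trail g w).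
Proof.
elim: w g => // x w IHw g.
rewrite winv_cons trail_cat gval_winv gval_cons mulgA IHw mulgK /= rev_cons.
by rewrite medge_linv cats1.
Qed.

Lemma mem_trail_winv g w : trail g (winv w) =i trail (g * (gval G w)^-1) w.
Proof. by move=> e; rewrite -{1}(mulgVK (gval G w) g) trail_winv mem_rev. Qed.

Lemma trail_shift g h u v : {subset trail g u <= trail h v} ->
  forall k, {subset trail (k * g) u <= trail (k * h) v}.
Proof.
move=> uv k e; rewrite !trail_mulg => /mapP[e' /uv e'v ->].
by apply/mapP; exists e'.
Qed.

(** This is the condition under which [w] may be replaced by [w ++ winv w ++ w'] with the same value
    in every inverse monoid that [G] extends ([value_below]). Edges are compared without their
    orientation. *)
Definition below w' w : bool :=
  (gval G w' == gval G w) && all [in trail 1 w] (trail 1 w').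

Lemma belowP w' w : reflect
  (gval G w' = gval G w /\ {subset trail 1 w' <= trail 1 w}) (below w' w).
Proof.
apply: (iffP andP) => [[/eqP-> /allP ?]|[-> ?]]; first by split.
by split=> //; apply/allP.
Qed.

Lemma below_gval w' w : below w' w -> gval G w' = gval G w.
Proof. by case/belowP. Qed.

Lemma below_trail w' w g : below w' w -> {subset trail g w' <= trail g w}.
Proof. by case/belowP=> _ /trail_shift/(_ g); rewrite mulg1. Qed.

Lemma below_refl w : below w w.
Proof. by apply/belowP; split. Qed.

Lemma below_trans v u w : below u v -> below v w -> below u w.
Proof.
move=> /belowP[uvE uv] /belowP[vwE vw]; apply/belowP.
by rewrite uvE vwE; split=> // e /uv/vw.
Qed.

Lemma below_cat u' v' u v :
  below u' u -> below v' v -> below (u' ++ v') (u ++ v).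
Proof.
move=> u'u v'v; apply/belowP.
rewrite !gval_cat (below_gval u'u) (below_gval v'v).
split=> // e; rewrite !trail_cat !mem_cat (below_gval u'u).
by case/orP=> [/(below_trail u'u)->//|/(below_trail v'v)->]; rewrite orbT.
Qed.

Lemma below_winv u v : below u v -> below (winv u) (winv v).
Proof.
move=> uv; apply/belowP; rewrite !gval_winv (below_gval uv); split=> // e.
by rewrite !mem_trail_winv (below_gval uv); apply: below_trail.
Qed.

Lemma below_nil w : below w [::] -> w = [::].
Proof.
case/belowP=> _ sub; apply: size0nil; rewrite -(size_trail 1).
by case: (trail 1 w) sub => // e s /(_ e); rewrite mem_head => /(_ isT).
Qed.

Lemma below_flatten us vs : all2 below us vs -> below (flatten us) (flatten vs).
Proof.
elim: us vs => [|u us IHus] [|v vs] //=; first by move=> _; apply: below_refl.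
by case/andP=> uv /IHus; apply: below_cat.
Qed.

Lemma below_prefix d w : {subset trail 1 d <= trail 1 w} ->
  below (d ++ (winv d ++ w)) w.
Proof.
move=> dw; apply/belowP; rewrite !gval_cat gval_winv mulVKg; split=> // e.
rewrite !trail_cat !mem_cat mem_trail_winv gval_winv mulgK.
by case/or3P => // /dw.
Qed.

Lemma below_suffix d w : {subset trail (gval G w) d <= trail 1 w} ->
  below (w ++ d ++ winv d) w.
Proof.
move=> dw; apply/belowP; rewrite !gval_cat gval_winv mulgV mulg1; split=> // e.
rewrite !trail_cat !mem_cat mem_trail_winv mulgK mul1g.
by case/or3P => // /dw.
Qed.

Lemma medge_eq h x g y : medge h x = medge g y ->
  h = g /\ x = y \/ h = g * glet G y /\ x = linv y.
Proof.
case: x y => [a [|]] [b [|]] [] /=.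
- by move=> + ab; rewrite ab => /mulIg->; left.
- move=> + ab; rewrite ab => <-; right.
  by rewrite -[(b, false)]/(linv (b, true)) glet_linv mulgK.
- by move=> -> ->; right.
- by move=> -> ->; left.
Qed.

Lemma trail_mem g w h x : medge h x \in trail g w -> exists u y v,
  w = u ++ y :: v /\ (h = g * gval G u /\ x = y \/
                      h = g * gval G (rcons u y) /\ x = linv y).
Proof.
elim: w g => //= y w IHw g; rewrite inE => /orP[/eqP/medge_eq hx|].
  exists [::], y, w; split=> //.
  by rewrite /= gval_cons gval_nil !mulg1.
case/IHw=> u [z [v [-> hx]]]; exists (y :: u), z, v.
by rewrite /= !gval_cons !mulgA.
Qed.

Lemma trail_vertex g w h x : medge h x \in trail g w ->
  exists u v, w = u ++ v /\ g * gval G u = h.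
Proof.
case/trail_mem=> u [y [v [-> [[-> _]|[-> _]]]]]; first by exists u, (y :: v).
by exists (rcons u y), v; rewrite cat_rcons.
Qed.

End Trail.

(** * Parity of edge traversals *)

(** Grouping equal entries, the count is the sum of the multiplicities of the distinct entries
    satisfying [P]. *)
Lemma even_count (T : eqType) (P : pred T) (s : seq T) :
  {in s, forall x, P x -> ~~ odd (count_mem x s)} -> ~~ odd (count P s).
Proof.
move=> ev; rewrite -(permP (perm_count_undup s)) count_flatten -map_comp.
have : {subset undup s <= s} by move=> x; rewrite mem_undup.
elim: (undup s) => //= x t IHt sub.
rewrite oddD (negPf (IHt _)) => [|y yt]; last exact/sub/mem_behead.
rewrite addbF count_nseq oddM; case Px: (P x) => //=.
by apply: ev => //; apply/sub/mem_head.
Qed.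

Section Parity.
Variables (A : finType) (G : agroup A).
Implicit Types (g h : G) (x : letter A) (u v w d : word A) (e : G * A).

Definition parity e g w : bool := odd (count_mem e (trail g w)).

Lemma parity_cat e g u v :
  parity e g (u ++ v) = parity e g u (+) parity e (g * gval G u) v.
Proof. by rewrite /parity trail_cat count_cat oddD. Qed.

Lemma parity_winv e w : gval G w = 1 -> parity e 1 (winv w) = parity e 1 w.
Proof.
move=> w1; have := trail_winv (1 : G) w; rewrite w1 mul1g /parity => ->.
by rewrite count_rev.
Qed.

(** A cancelled pair [x], [linv x] traverses one edge twice, so the parity is well defined on F. *)
Lemma parity_freely e g u v : freely_equal u v -> parity e g u = parity e g v.
Proof.
elim=> // [? ? ? _ -> _ -> //|u1 x v1].
rewrite !parity_cat; congr (_ (+) _).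
rewrite /parity /= medge_linv glet_linv mulgK.
by rewrite addnA !oddD addbb.
Qed.

Definition free_parity e (f : free_group A) : bool :=
  parity e 1 (repr (f : free_group_type A)).

Lemma free_parity_fword e w : free_parity e (fword w) = parity e 1 w.
Proof. exact/parity_freely/freely_repr. Qed.

Lemma free_parityM e (x y : free_group A) : free_lift G x = 1 ->
  free_parity e (x * y) = free_parity e x (+) free_parity e y.
Proof.
rewrite -(fword_repr x) -(fword_repr y) free_liftE => x1.
by rewrite -[_ * _]fword_cat !free_parity_fword parity_cat [gval G _]x1 mulg1.
Qed.

Lemma free_parityV e (x : free_group A) : free_lift G x = 1 ->
  free_parity e x^-1 = free_parity e x.
Proof.
rewrite -(fword_repr x) free_liftE => x1.
by rewrite -[_^-1]fword_winv !free_parity_fword parity_winv.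
Qed.

(* The signed number of traversals of an edge is additive on the kernel of
   F -> G, so modulo 2 it vanishes on commutators and squares. *)
Lemma Ab2_parity e w : gval (Ab 2 G) w = 1 -> parity e 1 w = false.
Proof.
pose K := kernel (free_lift G).
have KC : inverse_submonoid K by have [] := ns_normal K.
pose S := [set x | ns_set K x /\ free_parity e x = false]%classic.
have SC : inverse_submonoid S.
  split=> [|x y [Kx Sx] [Ky Sy]|x [Kx Sx]].
  - by split; [apply: ns1|rewrite -[1]/(fword [::]) free_parity_fword].
  - by split; [apply: nsM|rewrite free_parityM // Sx Sy].
  - by split; [apply: nsV|rewrite free_parityV].
move=> /Ab_gval1[x Cx [y Py xy]].
suff [_] : S (fword w) by rewrite free_parity_fword.
rewrite -xy; have [_ SM _] := SC; apply: SM.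
  apply: (smallest_sub SC _ Cx) => _ [u Ku [v Kv <-]].
  have Kuv : ns_set K (u * v) by apply: nsM.
  have Ku' := nsV Ku; have Kv' := nsV Kv.
  split; first by apply: nsM; last apply: nsM.
  rewrite [commg _ _]/commg [conjg _ _]/conjg !free_parityM // !free_parityV //.
  by case: (free_parity e u); case: (free_parity e v).
apply: (smallest_sub SC _ Py) => _ [u Ku <-].
by split; [apply: nsM|rewrite expgS expg1 free_parityM // addbb].
Qed.

(** A letter changes membership in [S] exactly when its edge crosses the boundary of [S]; the
    changes telescope. *)
Lemma trail_crossing (S : pred G) g w :
  odd (count (fun e => S e.1 (+) S (e.1 * glet G (e.2, false))) (trail g w))
  = S g (+) S (g * gval G w).
Proof.
elim: w g => [|x w IHw] g /=; first by rewrite gval_nil mulg1 addbb.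
rewrite oddD IHw gval_cons mulgA oddb.
suff -> : S (medge g x).1 (+) S ((medge g x).1 * glet G ((medge g x).2, false))
  = S g (+) S (g * glet G x) by rewrite -addbA (addbA (S (_ * _))) addbb.
case: x => a [|] //; rewrite /medge /= addbC; congr (S _ (+) _).
by rewrite -[(a, true)]/(linv (a, false)) glet_linv mulgVK.
Qed.

(** Let [S] be the set of vertices reachable from 1 along edges of odd parity. No such edge crosses
    the boundary of [S], so [w] crosses it evenly often and ends in [S]. *)
Lemma odd_trail_path w : exists2 d, gval G d = gval G w &
  forall e, e \in trail 1 d -> parity e 1 w.
Proof.
pose S h := `[< exists2 d, gval G d = h &
  forall e, e \in trail 1 d -> parity e 1 w >].
have Sstep d x : (forall e, e \in trail 1 d -> parity e 1 w) ->
    parity (medge (gval G d) x) 1 w -> S (gval G d * glet G x).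
  move=> dP xP; apply/asboolP; exists (rcons d x).
    by rewrite -cats1 gval_cat gval_cons gval_nil mulg1.
  move=> e; rewrite -cats1 trail_cat mem_cat mul1g inE.
  by case/orP=> [/dP//|/eqP->].
have S1 : S 1 by apply/asboolP; exists [::]; rewrite ?gval_nil.
case: (boolP (S (gval G w))) => [/asboolP//|Sw].
have := trail_crossing S (1 : G) w; rewrite mul1g S1 (negPf Sw) /= => /idPn[].
apply: even_count => -[h a] _ /=; apply: contraL => hP.
suff -> : S h = S (h * glet G (a, false)) by rewrite addbb.
apply/idP/idP=> /asboolP[d dh dP].
  by rewrite -dh; apply: Sstep => //; rewrite dh.
have -> : h = gval G d * glet G (a, true).
  by rewrite dh -[(a, true)]/(linv (a, false)) glet_linv mulgK.
apply: Sstep => //.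
by rewrite dh /medge /= -[(a, true)]/(linv (a, false)) glet_linv mulgK.
Qed.

End Parity.

(** * Projecting paths from an expansion to the base group *)

Section AbBelow.
Variables (A : finType) (m : nat) (Q : agroup A).
Implicit Types (u v w : word A).

Lemma trail_Ab_proj g w :
  trail (Ab_proj g) w = [seq (Ab_proj e.1, e.2) | e <- trail (g : Ab m Q) w].
Proof.
have gletE x : Ab_proj (glet (Ab m Q) x) = glet Q x.
  by rewrite -[glet _ _]mulg1 -(gval_nil (Ab m Q)) -gval_cons gval_Ab_proj
             gval_cons gval_nil mulg1.
elim: w g => //= x w IHw g; rewrite -IHw Ab_proj_morph gletE.
by rewrite /medge; case: x.2; rewrite ?Ab_proj_morph ?gletE.
Qed.

Lemma below_Ab u v : below (Ab m Q) u v -> below Q u v.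
Proof.
move=> /belowP[uv sub]; apply/belowP; split; first exact: gval_Ab_eq uv.
have p1 : Ab_proj (1 : Ab m Q) = 1.
  by rewrite -(gval_nil (Ab m Q)) gval_Ab_proj gval_nil.
by move=> e; rewrite -p1 !trail_Ab_proj => /mapP[f /sub fv ->]; apply: map_f.
Qed.

End AbBelow.

Section Iterate.
Variables (A : finType) (Q : agroup A).
Implicit Types (u v w : word A).

Lemma below_iter n u v : below (iter n (Ab 2) Q) u v -> below Q u v.
Proof. by elim: n => //= n IHn /below_Ab. Qed.

Lemma gval_iter_eq n u v :
  gval (iter n (Ab 2) Q) u = gval (iter n (Ab 2) Q) v -> gval Q u = gval Q v.
Proof. by elim: n => //= n IHn /gval_Ab_eq. Qed.

Lemma gval_iter_eq1 n u : gval (iter n (Ab 2) Q) u = 1 -> gval Q u = 1.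
Proof. by elim: n => //= n IHn /gval_Ab_eq1. Qed.

End Iterate.

(** * Lifting polygons to the free group *)

Section TrailSplit.
Variables (A : finType) (G : agroup A).
Implicit Types (g h : G) (x : letter A) (u v w d : word A).

Lemma trail_flatten_vertex g h x (ms : seq (word A)) :
  medge h x \in trail g (flatten ms) -> exists m1 a b m2,
    ms = m1 ++ (a ++ b) :: m2 /\ g * gval G (flatten m1 ++ a) = h.
Proof.
elim: ms g => //= w ms IHms g; rewrite trail_cat mem_cat.
case/orP=> [/trail_vertex[a [b [-> <-]]]|/IHms[m1 [a [b [m2 [-> <-]]]]]].
  by exists [::], a, b, ms.
by exists (w :: m1), a, b, m2; rewrite /= -catA gval_cat mulgA.
Qed.

Lemma trail_exit (C : pred (G * A)) g d : exists d1 d2,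
  [/\ d = d1 ++ d2, all C (trail g d1) &
      forall x d3, d2 = x :: d3 -> ~~ C (medge (g * gval G d1) x)].
Proof.
elim: d g => [|x d IHd] g; first by exists [::], [::].
case Cx: (C (medge g x)); last first.
  by exists [::], (x :: d); split=> // y d3 [<- _]; rewrite gval_nil mulg1 Cx.
have [d1 [d2 [-> Cd1 d2P]]] := IHd (g * glet G x).
by exists (x :: d1), d2; rewrite /= Cx gval_cons mulgA.
Qed.

End TrailSplit.

Lemma all2_cat_split (S T : Type) (r : S -> T -> bool) s t1 t2 :
  all2 r s (t1 ++ t2) ->
  exists s1 s2, [/\ s = s1 ++ s2, all2 r s1 t1 & all2 r s2 t2].
Proof.
elim: t1 s => [|y t1 IHt] s /=; first by exists [::], s.
case: s => //= x s /andP[xy /IHt[s1 [s2 [-> rs1 rs2]]]].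
by exists (x :: s1), s2; rewrite /= xy.
Qed.

Lemma all2_cat_intro (S T : Type) (r : S -> T -> bool) s1 s2 t1 t2 :
  all2 r s1 t1 -> all2 r s2 t2 -> all2 r (s1 ++ s2) (t1 ++ t2).
Proof.
by elim: s1 t1 => [|x s1 IHs] [|y t1] //= /andP[-> /IHs IH] /IH.
Qed.

(* The path [d] runs inside both the first and the last side of the polygon
   and ends on the side [a ++ b]; cutting along it leaves two polygons with
   fewer sides. *)
Lemma polygon_cut (A : finType) (R : agroup A) w1 mid wn :
    gval (Ab 2 R) (w1 ++ flatten mid ++ wn) = 1 -> (0 < size mid)%N ->
  exists d m1 a b m2, [/\ mid = m1 ++ (a ++ b) :: m2,
    gval R d = gval R (w1 ++ flatten m1 ++ a),
    {subset trail (1 : R) d <= trail 1 w1} &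
    {subset trail (gval R wn) d <= trail 1 wn}].
Proof.
move=> par1 mid0; have := gval_Ab_eq1 par1; rewrite !gval_cat mulgA => R1.
have wnE : gval R wn * (gval R w1 * gval R (flatten mid)) = 1.
  by rewrite -(mulg1_eq R1) mulVg.
have [d dw dP] := @odd_trail_path _ R w1.
(* The last side starts at [g]; [d] is followed as long as it stays inside that side. *)
pose g := gval R w1 * gval R (flatten mid).
have [d1 [d2 [dE /allP dC dexit]]] := trail_exit [in trail g wn] 1 d.
have d1w : {subset trail (1 : R) d1 <= trail 1 w1}.
  move=> e ed1; have /dP : e \in trail (1 : R) d.
    by rewrite dE trail_cat mem_cat ed1.
  by rewrite -has_pred1 has_count; apply: odd_gt0.
have d1n : {subset trail (gval R wn) d1 <= trail 1 wn}.
  by have /trail_shift/(_ (gval R wn)) := dC; rewrite mulg1 wnE.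
(* If [d] never leaves the last side, the cut ends where [w1] ends, at the start of the first middle
   side. *)
case: d2 => [|x d3] in dE dexit.
  case: mid mid0 => // m0 mid _ in par1 R1 wnE g dC dexit d1n *.
  exists d1, [::], [::], m0, mid; split=> //.
  by rewrite cats0 /= cats0 -dw dE cats0.
have := dexit _ _ erefl; rewrite mul1g => xn.
have xd : medge (gval R d1) x \in trail (1 : R) d.
  by rewrite dE trail_cat mul1g mem_cat mem_head orbT.
(* The edge by which [d] leaves the last side is traversed oddly often by [w1] and evenly often by
   the whole polygon, hence also by some middle side. *)
have /(trail_flatten_vertex (ms := mid)) : medge (gval R d1) x \in
    trail (gval R w1) (flatten mid).
  have := Ab2_parity (medge (gval R d1) x) par1.
  rewrite !parity_cat (dP _ xd) mul1g /parity.
  rewrite [X in _ (+) (_ (+) odd X)](count_memPn _) // addbF.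
  by move=> /negbFE/odd_gt0; rewrite -has_count has_pred1.
move=> [m1 [a [b [m2 [midE hE]]]]]; exists d1, m1, a, b, m2; split=> //.
by rewrite gval_cat hE.
Qed.

Section CycleLift.
Variables (A : finType) (Q : agroup A).

(** Induction on [n]: the top level of [Ab 2] provides a cut in the Cayley graph of [R], and the
    remaining levels lift the two parts, which have fewer sides. *)
Lemma cycle_lift n (ws : seq (word A)) : (size ws <= n.+1)%N ->
    gval (iter n (Ab 2) Q) (flatten ws) = 1 ->
  exists2 ws', all2 (below Q) ws' ws & freely_equal (flatten ws') [::].
Proof.
elim: n ws => [|n IHn] [|w1 ws] //=.
- by exists [::] => //; apply: freely_refl.
- case: ws => // _ /=; rewrite cats0 => w1E.
  exists [:: [::]]; last exact: freely_refl.
  by rewrite /= andbT; apply/belowP; rewrite w1E gval_nil.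
- by exists [::] => //; apply: freely_refl.
set R := iter n (Ab 2) Q => szws wsE.
have bQ u v : below R u v -> below Q u v by apply: below_iter.
elim/last_ind: ws szws wsE => [|mid wn _] szws wsE.
  exists [:: [::]]; last exact: freely_refl.
  have := gval_iter_eq1 (n := n.+1) wsE; rewrite cats0 => w1E.
  by rewrite /= andbT; apply/belowP; rewrite w1E gval_nil.
have {}wsE : gval (Ab 2 R) (w1 ++ flatten mid ++ wn) = 1.
  by rewrite -[RHS]wsE -cats1 flatten_cat /= cats0.
(* A 2-gon is given an empty middle side. The cut then joins both ends of [w1], so [d] and [winv d]
   can replace the two sides. *)
case: mid => [|w2 mid'] in szws wsE *.
  have [//|//|d [m1 [a [b [m2 [midE dE dw1 dwn]]]]]] :=
    @polygon_cut _ R w1 [:: [::]] wn.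
  have {}dE : gval R d = gval R w1.
    case: m1 midE dE => [|? [|? ?]] //= [].
    by case: a => [|? ?] //= _ _; rewrite cats0.
  have wnE : (gval R d)^-1 = gval R wn.
    by apply: mulg1_eq; rewrite dE -gval_cat; apply: gval_Ab_eq1 wsE.
  exists [:: d; winv d]; last first.
    by apply/freely_gval; rewrite /= cats0 gval_cat gval_winv mulgV gval_nil.
  rewrite /= !andbT; apply/andP; split; apply/bQ/belowP; first by [].
  rewrite gval_winv; split=> // e.
  by rewrite mem_trail_winv mul1g wnE; apply: dwn.
have [//|d [m1 [a [b [m2 [midE dE dw1 dwn]]]]]] := polygon_cut wsE.
have R1 : gval R (w1 ++ flatten (w2 :: mid') ++ wn) = 1.
  exact: gval_Ab_eq1 wsE.
move: R1 szws; rewrite midE => R1 szws.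
(* The cut [d] is merged into the first side of one part and into the last side of the other, so
   that it does not count as a side of its own. *)
have [B BP BE] : exists2 B, all2 (below Q) B ((winv d ++ w1) :: m1 ++ [:: a]) &
    freely_equal (flatten B) [::].
  apply: IHn; first by move: szws; rewrite /= size_rcons !size_cat /=; lia.
  rewrite /= flatten_cat /= cats0 !gval_cat gval_winv -mulgA mulgA dE !gval_cat.
  by rewrite -!mulgA mulVg.
have [C CP CE] : exists2 C, all2 (below Q) C (b :: m2 ++ [:: wn ++ d]) &
    freely_equal (flatten C) [::].
  apply: IHn; first by move: szws; rewrite /= size_rcons !size_cat /=; lia.
  rewrite /= flatten_cat /= cats0 !gval_cat.
  rewrite !mulgA; apply/(mulgI (gval R d)); rewrite mulg1 !mulgA.
  move: R1; rewrite dE !(gval_cat, flatten_cat, gval_nil) /= ?gval_cat !mulgA.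
  by move=> ->; rewrite mul1g.
have bw1 : below Q (d ++ (winv d ++ w1)) w1 by apply/bQ/below_prefix.
have bwn : below Q ((wn ++ d) ++ winv d) wn.
  by rewrite -catA; apply/bQ/below_suffix.
case: B BP BE => [|c' B] //= /andP[bc /all2_cat_split[m1' [Ba [-> bm1]]]].
case: Ba => [|a' [|? ?]] //=; rewrite ?andbT ?andbF // => ba BE.
case: C CP CE => [|b' C] //= /andP[bb /all2_cat_split[m2' [Cz [-> bm2]]]].
case: Cz => [|z' [|? ?]] //=; rewrite ?andbT ?andbF // => bz CE.
(* The product of the new sides is the product of the two lifted parts conjugated by [d]. The outer
   sides stay below [w1] and [wn] because [d] runs inside both. *)
exists ((d ++ c') :: (m1' ++ (a' ++ b') :: m2') ++ [:: z' ++ winv d]).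
  rewrite -cats1 /=; apply/andP; split.
    exact: below_trans (below_cat (below_refl _ _) bc) bw1.
  apply: all2_cat_intro; last first.
    by rewrite /= andbT; apply: below_trans (below_cat bz (below_refl _ _)) bwn.
  by apply: all2_cat_intro => //=; rewrite below_cat.
apply/freely_gval; move/freely_gval: CE; move/freely_gval: BE.
rewrite /= !(flatten_cat, gval_cat) /=.
rewrite gval_winv gval_nil !mulg1 -/(flatten m2').
move: (gval _ c') (gval _ (flatten m1')) (gval _ a') => c m a'' cma.
move: (gval _ b') (gval _ (flatten m2')) (gval _ z') => b'' f z bfz.
rewrite [LHS](_ : _ = gval _ d * (c * (m * a'')) * (b'' * (f * z)) *
  (gval _ d)^-1); last by rewrite !mulgA.
by rewrite cma bfz !mulg1 mulgV.
Qed.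

End CycleLift.

(** * Free reduction and common prefixes *)

Section Reduction.
Variable A : finType.
Implicit Types (x y : letter A) (u v w r : word A).

Definition push x r :=
  if r is y :: r' then if y == linv x then r' else x :: r else [:: x].
Definition reduce w := foldr push [::] w.
Definition noncancelling x y := y != linv x.
Definition reduced w := sorted noncancelling w.

Lemma reduced_push x r : reduced r -> reduced (push x r).
Proof.
case: r => //= y r pr; case: eqP => [_|/eqP yx]; first exact: path_sorted pr.
by rewrite /= /noncancelling yx.
Qed.

Lemma reduce_reduced w : reduced (reduce w).
Proof. by elim: w => //= x w; apply: reduced_push. Qed.

(** Letters thus act on reduced words by bijections (van der Waerden's argument), which makes
    [reduce] invariant under free equality. *)
Lemma push_linv x r : reduced r -> push x (push (linv x) r) = r.
Proof.
case: r => [|y r] /=; first by rewrite eqxx.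
rewrite linvK; case: eqP => [-> |_ _] /=; last by rewrite eqxx.
by case: r => //= z r /andP[/negPf->].
Qed.

Lemma reduce_cat u v : reduce (u ++ v) = foldr push (reduce v) u.
Proof. exact: foldr_cat. Qed.

Lemma reduce_freely u v : freely_equal u v -> reduce u = reduce v.
Proof.
elim=> // [? ? ? _ -> _ -> //|u1 x v1].
by rewrite !reduce_cat /= push_linv // reduce_reduced.
Qed.

Lemma freely_push x r : freely_equal (x :: r) (push x r).
Proof.
case: r => [|y r] /=; first exact: freely_refl.
by case: eqP => [->|_]; [exact: (freely_cancel [::])|exact: freely_refl].
Qed.

Lemma freely_reduce w : freely_equal w (reduce w).
Proof.
elim: w => [|x w IHw] /=; first exact: freely_refl.
apply: freely_trans (freely_push _ _).
by rewrite -cat1s -(cat1s x (reduce w)); apply: freely_catl.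
Qed.

Lemma reduced_reduce r : reduced r -> reduce r = r.
Proof.
elim: r => //= x r IHr pr; rewrite IHr; last exact: path_sorted pr.
by case: r pr {IHr} => //= y r /andP[/negPf->].
Qed.

Lemma reduce_eq w r : reduced r -> freely_equal w r -> reduce w = r.
Proof. by move=> rr /reduce_freely->; rewrite reduced_reduce. Qed.

Lemma reduced_winv r : reduced r -> reduced (winv r).
Proof.
rewrite /reduced /winv rev_sorted sorted_map; apply: sub_sorted => x y.
by rewrite /noncancelling /= linvK eq_sym.
Qed.

Lemma reduce_winv w : reduce (winv w) = winv (reduce w).
Proof.
apply: reduce_eq; first exact/reduced_winv/reduce_reduced.
exact/freely_winv/freely_reduce.
Qed.

Lemma trail_reduce (G : agroup A) (g : G) w :
  {subset trail g (reduce w) <= trail g w}.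
Proof.
elim: w g => //= x w IHw g e; rewrite inE => eP.
have : e \in medge g x :: trail (g * glet G x) (reduce w).
  case: (reduce w) eP => [|y r] //=; case: eqP => [->|_] //= eP.
  by rewrite glet_linv mulgK !inE eP !orbT.
by rewrite inE => /orP[->//|/IHw->]; rewrite orbT.
Qed.

Lemma below_reduce (G : agroup A) w : below G (reduce w) w.
Proof.
apply/belowP; split; first by apply/esym/gval_freely/freely_reduce.
exact: trail_reduce.
Qed.

(** For reduced words this is the position of the projection of [v] on the geodesic from 1 to [u] in
    the Cayley tree of F. *)
Fixpoint lcp u v : nat :=
  if (u, v) is (x :: u', y :: v') then
    if x == y then (lcp u' v').+1 else 0%N
  else 0%N.

Lemma lcp_size u v : (lcp u v <= size u)%N.
Proof.
by elim: u v => [|x u IHu] [|y v] //=; case: eqP => // _; apply: IHu.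
Qed.

Lemma take_lcp u v : take (lcp u v) u = take (lcp u v) v.
Proof.
by elim: u v => [|x u IHu] [|y v] //=; case: eqP => //= ->; rewrite IHu.
Qed.

Lemma lcpxx u : lcp u u = size u.
Proof. by elim: u => //= x u ->; rewrite eqxx. Qed.

Lemma lcp_nil u : lcp u [::] = 0%N.
Proof. by case: u. Qed.

Lemma lcp_diverge u v x y r t :
  drop (lcp u v) u = x :: r -> drop (lcp u v) v = y :: t -> x != y.
Proof.
elim: u v => [|a u IHu] [|b v] //=; case: eqVneq => [_|ab] /=; first exact: IHu.
by case=> <- _ [<- _].
Qed.

Lemma reduced_join u x y v : reduced (rcons u x) -> reduced (y :: v) ->
  noncancelling x y -> reduced (rcons u x ++ y :: v).
Proof.
case: u => [|z u] /=; first by move=> _ -> ->.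
by rewrite cat_path last_rcons /= => -> -> ->.
Qed.

Lemma reduced_catr u v : reduced (u ++ v) -> reduced v.
Proof. by elim: u => //= x u IHu /path_sorted. Qed.

End Reduction.

(** * Lifting a word subdivided at given positions *)

Lemma drop_take_cat (T : Type) (s : seq T) a b c :
  (a <= b)%N -> (b <= c)%N -> (b <= size s)%N ->
  drop a (take b s) ++ drop b (take c s) = drop a (take c s).
Proof.
move=> ab bc bs; rewrite -[in RHS](cat_take_drop b (take c s)) take_takel //.
rewrite [in RHS]drop_cat size_takel //; case: ltnP => // ba.
have -> : a = b by apply/eqP; rewrite eqn_leq ab.
by rewrite subnn drop0 drop_oversize // size_takel.
Qed.

Definition pieces (T : Type) (W : seq T) (a : nat) (cuts : seq nat) :=
  pairmap (fun b c => drop b (take c W)) a cuts.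

Lemma flatten_take_pieces (T : Type) (W : seq T) a cuts i :
  path leq a cuts -> all (fun c => c <= size W)%N cuts -> (i < size cuts)%N ->
  flatten (take i.+1 (pieces W a cuts)) = drop a (take (nth 0%N cuts i) W).
Proof.
elim: cuts a i => //= b cuts IHc a i /andP[ab pc] /andP[bW cW].
case: i => [|i] /= ilt; first by rewrite take0 /= cats0.
rewrite IHc // drop_take_cat //.
by move: pc => /(order_path_min leq_trans)/allP; apply; apply: mem_nth.
Qed.

Lemma all2_take_drop (T S : Type) (r : T -> S -> bool) s t n : all2 r s t ->
  all2 r (take n s) (take n t) /\ all2 r (drop n s) (drop n t).
Proof.
elim: n s t => [|n IHn] [|x s] [|y t] //= /andP[-> /IHn[-> ->]] //.
Qed.

Lemma flatten_take_drop (T : Type) (ss : seq (seq T)) i j : (i <= j)%N ->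
  flatten (take j ss) = flatten (take i ss) ++ flatten (drop i (take j ss)).
Proof.
move=> ij; rewrite -flatten_cat -[in LHS](cat_take_drop i (take j ss)).
by rewrite take_takel.
Qed.

Section CutLift.
Variables (A : finType) (Q : agroup A).

(** The pieces of [W] between the cuts form a polygon with [winv w], to which [cycle_lift] applies;
    [f c] is the product of the lifted pieces up to position [c]. *)
Lemma cut_lift n (W w : word A) (cuts : seq nat) :
    (size cuts < n)%N -> all (fun c => c <= size W)%N cuts ->
    gval (iter n (Ab 2) Q) W = gval (iter n (Ab 2) Q) w ->
  exists f : nat -> word A,
  [/\ forall c, c \in cuts -> below Q (f c) (take c W),
      forall c c', c \in cuts -> c' \in cuts -> (c <= c')%N ->
        exists2 t, below Q t (drop c (take c' W)) &
                   freely_equal (f c ++ t) (f c') &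
      size W \in cuts ->
        exists2 w', below Q w' w & freely_equal w' (f (size W))].
Proof.
move=> szc cW Ww.
pose s := rcons (sort leq cuts) (size W).
have memc c : c \in cuts -> c \in s.
  by move=> cc; rewrite mem_rcons inE mem_sort cc orbT.
have sW : all (fun c => c <= size W)%N s.
  by rewrite all_rcons leqnn all_sort.
have ss : sorted leq s.
  rewrite (sorted_pairwise leq_trans) pairwise_rcons all_sort cW.
  by rewrite -(sorted_pairwise leq_trans); apply: sort_sorted leq_total _.
have ps : path leq 0%N s by rewrite path_min_sorted //; apply/allP.
pose ts := pieces W 0 s.
have szs : size s = (size cuts).+1 by rewrite size_rcons size_sort.
have szts : size ts = (size cuts).+1 by rewrite size_pairmap.
have tsE c : c \in s -> flatten (take (index c s).+1 ts) = take c W.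
  by move=> cs; rewrite flatten_take_pieces ?index_mem // drop0 nth_index.
have tsW : flatten ts = W.
  rewrite -[ts]take_size szts flatten_take_pieces ?szs // drop0.
  by rewrite nth_rcons size_sort ltnn eqxx take_size.
have [||ws' /all2_cat_split[ts' [zs [-> tP zP]]] wsE] :=
  @cycle_lift _ Q n (ts ++ [:: winv w]).
- by rewrite size_cat szts addn1.
- rewrite flatten_cat tsW gval_cat Ww /= cats0 gval_winv.
  exact: mulgV.
case: zs zP wsE => [|z [|? ?]] //=; rewrite ?andbT ?andbF // => zw.
rewrite flatten_cat /= cats0 => /freely_gval; rewrite gval_cat gval_nil => tz.
pose f c := flatten (take (index c s).+1 ts').
have fP c : c \in s -> below Q (f c) (take c W).
  move=> cs; rewrite -tsE //; apply: below_flatten.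
  by have [] := all2_take_drop (index c s).+1 tP.
exists f; split=> [c /memc/fP//|c c' /memc cs /memc cs' cc'|/memc Ws].
  have icc' : (index c s <= index c' s)%N.
    rewrite leqNgt; apply/negP => ic'c.
    have c'c : (c' <= c)%N.
      exact: (sorted_leq_index leq_trans leqnn ss) (ltnW ic'c).
    have cE : c = c' by apply/eqP; rewrite eqn_leq cc'.
    by rewrite cE ltnn in ic'c.
  exists (flatten (drop (index c s).+1 (take (index c' s).+1 ts'))); last first.
    by rewrite /f -flatten_take_drop //; apply: freely_refl.
  have [tP' _] := all2_take_drop (index c' s).+1 tP.
  have [_ /below_flatten] := all2_take_drop (index c s).+1 tP'.
  congr (below Q _ _).
  have /(flatten_take_drop ts) : ((index c s).+1 <= (index c' s).+1)%N by [].
  by rewrite !tsE // => ->; rewrite drop_size_cat // size_takel // (allP sW).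
exists (winv z); first by rewrite -[w]winvK below_winv.
(* If [size W] is itself a cut, its first occurrence in [s] is not the last entry. The pieces after
   it are empty, and only the empty word is below an empty word. *)
set i := (index (size W) s).+1.
have dE : flatten (drop i ts') = [::].
  apply: (@below_nil _ Q); have [_ /below_flatten] := all2_take_drop i tP.
  rewrite [X in below _ _ X -> _](_ : _ = [::]) //; apply: size0nil.
  have : flatten (take i ts) ++ flatten (drop i ts) = W.
    by rewrite -flatten_cat cat_take_drop.
  rewrite tsE // take_size => /(congr1 size).
  by rewrite size_cat -[RHS]addn0 => /addnI.
have fE : f (size W) = flatten ts'.
  by rewrite -[in RHS](cat_take_drop i ts') flatten_cat dE cats0.
apply/freely_gval; rewrite fE gval_winv -(mulg1_eq tz).
exact: invgK.
Qed.

End CutLift.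

(** * Lifting vertex potentials, one edge at a time *)

Section PotentialLift.
Variables (A V : finType).
Implicit Types (u v w r : word A).

Lemma freely_inserted p q u :
  freely_equal (winv (p ++ u) ++ (p ++ q)) (winv u ++ q).
Proof.
by apply/freely_gval; rewrite winv_cat !gval_cat !gval_winv -!mulgA mulKg.
Qed.

Lemma freely_move u v w :
  freely_equal (u ++ v) w <-> freely_equal v (winv u ++ w).
Proof.
split=> /freely_gval e; apply/freely_gval; move: e; rewrite !gval_cat gval_winv.
  by move=> <-; rewrite mulKg.
by move=> ->; rewrite mulVKg.
Qed.

(** In the Cayley tree the geodesic from [u] to [v] goes back to the point where [u] leaves [W],
    follows [W] to the point where [v] leaves it, and then runs to [v]. Nothing cancels at the first
    junction, since [u] and [W] diverge there. *)
Lemma reduced_bridge W u v : reduced u -> reduced v ->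
  (lcp W u < lcp W v)%N ->
  reduce (winv u ++ v) = winv (drop (lcp W u) u) ++
    drop (lcp W u) (take (lcp W v) W) ++ drop (lcp W v) v.
Proof.
set l := lcp W u; set l' := lcp W v => ru rv ll.
have uE : u = take l W ++ drop l u by rewrite take_lcp cat_take_drop.
have vE : v = take l W ++ (drop l (take l' W) ++ drop l' v).
  rewrite catA -[X in X ++ drop l _](take_takel W (ltnW ll)) cat_take_drop.
  by rewrite take_lcp cat_take_drop.
apply: reduce_eq; last by rewrite {1}uE {1}vE; apply: freely_inserted.
have rt : reduced (drop l (take l' W) ++ drop l' v).
  by apply: (@reduced_catr _ (take l W)); rewrite -vE.
have rru : reduced (winv (drop l u)).
  by apply/reduced_winv/(@reduced_catr _ (take l W)); rewrite -uE.
have : (l < size W)%N by apply: leq_trans ll (lcp_size _ _).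
case dW: (drop l W) => [|y t] lW.
  by move: lW; rewrite -(cat_take_drop l W) dW cats0 size_take_min leq_min ltnn.
have dtE : drop l (take l' W) = y :: take (l' - l).-1 t.
  have -> : drop l (take l' W) = take (l' - l) (drop l W).
    by rewrite take_drop subnK // ltnW.
  by rewrite dW; case: (l' - l)%N (subn_gt0 l l') => [|k] //=; rewrite ll.
case du: (drop l u) rru rt => [|x s] //; rewrite dtE winv_cons cats1 => rru rt.
apply: reduced_join => //; rewrite /noncancelling linvK.
by have /= := lcp_diverge (u := W) (v := u) dW du; rewrite eq_sym.
Qed.

(** With [f x] moved to 1, the geodesic [W] from x to y is subdivided at the projections [l z] of
    all vertices and lifted together with [w]; the branches leaving [W] are kept. The last clause
    preserves the edges lifted before: each geodesic between values of [f] is replaced by a path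
    below it. *)
Lemma potential_step (Q : agroup A) n (f : V -> word A) x y w :
    (#|V| < n)%N ->
    gval (iter n (Ab 2) Q) (f x ++ w) = gval (iter n (Ab 2) Q) (f y) ->
  exists f' : V -> word A,
  [/\ forall z, gval Q (f' z) = gval Q (f z),
      exists2 w', below Q w' w & freely_equal (f' x ++ w') (f' y) &
      forall z z', exists2 r, below Q r (reduce (winv (f z) ++ f z')) &
                              freely_equal (f' z ++ r) (f' z')].
Proof.
move=> Vn xwy; pose f0 z := reduce (winv (f x) ++ f z).
pose W := f0 y; pose l z := lcp W (f0 z).
have rf0 z : reduced (f0 z) by apply: reduce_reduced.
have ff0 z (G : agroup A) : gval G (f0 z) = (gval G (f x))^-1 * gval G (f z).
  by rewrite -(gval_freely _ (freely_reduce _)) gval_cat gval_winv.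
have f0x : f0 x = [::].
  apply: reduce_eq => //; apply/freely_gval.
  by rewrite gval_cat gval_winv mulVg gval_nil.
pose cuts := [seq l z | z <- enum V].
have lc z : l z \in cuts by apply: map_f; rewrite mem_enum.
have [|||g [gP gt gw]] := @cut_lift _ Q n W w cuts.
- by rewrite size_map -cardE.
- by apply/allP=> _ /mapP[z _ ->]; apply: lcp_size.
- by rewrite ff0 -xwy gval_cat mulKg.
pose f' z := f x ++ g (l z) ++ drop (l z) (f0 z).
have f'E z : gval Q (f' z) = gval Q (f z).
  rewrite !gval_cat (below_gval (gP _ (lc z))) -gval_cat take_lcp cat_take_drop.
  by rewrite ff0 mulVKg.
exists f'; split=> //.
  have lx : l x = 0%N by rewrite /l f0x lcp_nil.
  have ly : l y = size W by rewrite /l lcpxx.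
  have g0 : g 0%N = [::].
    by apply: (@below_nil _ Q); have := gP _ (lc x); rewrite lx take0.
  have [|w' w'w w'E] := gw; first by rewrite -ly.
  exists w' => //; rewrite /f' lx ly g0 f0x drop_size /= !cats0.
  exact: freely_catl.
have key z z' : (l z <= l z')%N -> exists2 r,
    below Q r (reduce (winv (f0 z) ++ f0 z')) &
    freely_equal (f' z ++ r) (f' z').
  rewrite leq_eqVlt => /orP[/eqP ll|ll].
    (* Both branches leave [W] at the same point, so the geodesic between them is unchanged. *)
    exists (reduce (winv (drop (l z) (f0 z)) ++ drop (l z) (f0 z'))).
      rewrite -(reduce_freely (freely_inserted (take (l z) W) _ _)).
      have -> : take (l z) W ++ drop (l z) (f0 z) = f0 z.
        by rewrite take_lcp cat_take_drop.
      have -> : take (l z) W ++ drop (l z) (f0 z') = f0 z'.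
        by rewrite ll take_lcp cat_take_drop.
      exact: below_refl.
    apply/freely_gval; rewrite gval_cat -(gval_freely _ (freely_reduce _)).
    by rewrite /f' ll !gval_cat gval_winv -!mulgA mulVKg.
  have [t tW tE] := gt _ _ (lc z) (lc z') (ltnW ll).
  exists (winv (drop (l z) (f0 z)) ++ t ++ drop (l z') (f0 z')).
    rewrite (reduced_bridge (W := W)) //.
    by apply: below_cat (below_refl _ _) (below_cat tW (below_refl _ _)).
  apply/freely_gval; move/freely_gval: tE.
  rewrite /f' !gval_cat gval_winv => <-.
  by rewrite -!mulgA mulVKg.
have f0f z z' : reduce (winv (f0 z) ++ f0 z') = reduce (winv (f z) ++ f z').
  apply/reduce_freely/freely_gval.
  rewrite !gval_cat !gval_winv !ff0 invgM invgK.
  by rewrite -mulgA mulVKg.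
move=> z z'; rewrite -f0f; case: (leqP (l z) (l z')) => [|/ltnW] /key[r rP rE].
  by exists r.
exists (winv r).
  rewrite -[X in below _ _ X]winvK below_winv //.
  by rewrite -reduce_winv winv_cat winvK.
apply/freely_gval; move/freely_gval: rE; rewrite !gval_cat gval_winv => <-.
by rewrite mulgK.
Qed.

(* An entry (x, w, y) of L is an edge from x to y labelled w. *)
Lemma potential_lift (L : seq (V * word A * V)) (Q : agroup A)
    (h : V -> word A) :
    let H := iter (size L * #|V|.+1) (Ab 2) Q in
    (forall c, c \in L -> gval H (h c.1.1 ++ c.1.2) = gval H (h c.2)) ->
  exists2 f : V -> word A, forall x, gval Q (f x) = gval Q (h x) &
    forall c, c \in L ->
      exists2 w, below Q w c.1.2 & freely_equal (f c.1.1 ++ w) (f c.2).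
Proof.
elim: L Q h => [|[[x w] y] L IHL] Q h /= hP; first by exists h.
set Q' := iter #|V|.+1 (Ab 2) Q.
have hP' : forall c, c \in (x, w, y) :: L ->
    gval (iter (size L * #|V|.+1) (Ab 2) Q') (h c.1.1 ++ c.1.2) =
    gval (iter (size L * #|V|.+1) (Ab 2) Q') (h c.2).
  by rewrite /Q' -iterD addnC -mulSn; apply: hP.
(* The other edges are lifted first, over [Q'], which reserves [#|V|.+1] levels for the edge from x
   to y. *)
have [c cL|f fh fL] := IHL Q' h; first by apply: hP'; rewrite inE cL orbT.
have := gval_iter_eq (hP' _ (mem_head _ _)); rewrite /= gval_cat -!fh -gval_cat.
move=> /(potential_step (ltnSn _))[f' [f'f [w' w'w w'E] f'P]].
exists f' => [z|c]; first by rewrite f'f; apply: gval_iter_eq (fh z).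
rewrite inE => /orP[/eqP->|/fL[u uc uE]]; first by exists w'.
(* The geodesic between the old potentials is the reduced form of the old lift [u], hence below
   it. *)
have [r ru rE] := f'P c.1.1 c.2; exists r => //; apply: below_trans ru _.
move/freely_move/freely_sym/reduce_freely: uE => ->.
apply: below_iter #|V|.+1 _ _ _; apply: below_trans uc; exact: below_reduce.
Qed.

End PotentialLift.

(** * Replacing labels in an inverse monoid *)

Section InverseMonoid.
Variables (M : starMonoidType) (Mi : inverse_monoid M).
Implicit Types x y e f : M.

Lemma inverse_mulgVg x : x * x^-1 * x = x.
Proof. by have [_ /(_ erefl)[]] := Mi x x^-1. Qed.

Lemma idem_inv e : e * e = e -> e^-1 = e.
Proof. by move=> ee; apply/esym/Mi; rewrite !ee. Qed.

Lemma idemM e f : e * e = e -> f * f = f -> e * f * (e * f) = e * f.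
Proof.
move=> ee ff; have := inverse_mulgVg (e * f); rewrite invgM !idem_inv //.
by rewrite -!mulgA (mulgA f f) ff (mulgA e e) ee.
Qed.

Lemma idemC e f : e * e = e -> f * f = f -> e * f = f * e.
Proof.
by move=> ee ff; rewrite -[LHS]idem_inv ?idemM // invgM !idem_inv.
Qed.

Lemma idem_mulgV x : x * x^-1 * (x * x^-1) = x * x^-1.
Proof. by rewrite mulgA inverse_mulgVg. Qed.

(* For e idempotent, e * (x * x^-1) = e says that e <= x * x^-1 in the natural
   order of M. *)
Lemma absorb_eq e c d : e * (c * c^-1) = e -> e * (d * d^-1) = e ->
  c^-1 * d * (c^-1 * d) = c^-1 * d -> e * d = e * c.
Proof.
move=> ec ed gg; have gV : d^-1 * c = c^-1 * d.
  by rewrite -(idem_inv gg) invgM invgK.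
have -> : e * c = e * d * (c^-1 * d) by rewrite -gV -{1}ed !mulgA.
have -> : e * d = e * c * (c^-1 * d) by rewrite -{1}ec !mulgA.
by rewrite -[in RHS]mulgA gg.
Qed.

(** For [e] idempotent, [e * (y * y^-1)] equals [e * y * (e * y)^-1] and so depends only on
    [e * y]. *)
Lemma absorb_transfer e c d x : e * e = e -> e * d = e * c ->
  e * (c * x * (c * x)^-1) = e -> e * (d * x * (d * x)^-1) = e.
Proof.
move=> ee dc ecx; have ecomm y : e * (y * y^-1) = e * y * (e * y)^-1.
  rewrite invgM (idem_inv ee) -{1}ee -mulgA (idemC ee (idem_mulgV y)).
  by rewrite !mulgA.
by rewrite ecomm (_ : e * (d * x) = e * (c * x)) -?ecomm // !mulgA dc.
Qed.

End InverseMonoid.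

Section Extends.
Variables (A : finType) (M : invmonoid A) (Q : agroup A).
Hypothesis QM : extends Q M.
Implicit Types (u v w d : word A).

Let Mi := @im_inverse _ M.

Lemma letter_value_linv (x : letter A) :
  letter_value M (linv x) = (letter_value M x)^-1.
Proof. by case: x => a [|]; rewrite // /letter_value /= invgK. Qed.

Lemma value_winv w : value M (winv w) = (value M w)^-1.
Proof.
elim: w => [|x w IHw]; first by rewrite value_nil invg1.
rewrite winv_cons value_cat value_seq1 -[x :: w]cat1s value_cat value_seq1.
by rewrite letter_value_linv IHw invgM.
Qed.

Lemma extends_idem c d : gval Q c = gval Q d ->
  (value M c)^-1 * value M d * ((value M c)^-1 * value M d) =
  (value M c)^-1 * value M d.
Proof.
move=> cd; rewrite -value_winv -value_cat; apply: QM.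
by rewrite -[value Q _]/(gval Q _) gval_cat gval_winv cd mulVg.
Qed.

Lemma absorb_prefix c t : value M (c ++ t) * (value M (c ++ t))^-1 *
  (value M c * (value M c)^-1) = value M (c ++ t) * (value M (c ++ t))^-1.
Proof.
rewrite (idemC Mi (idem_mulgV Mi _) (idem_mulgV Mi _)) value_cat !mulgA.
by rewrite (inverse_mulgVg Mi).
Qed.

(** Induction along [d]: its next edge starts at a vertex that a prefix of [w] also reaches. By
    [absorb_eq] the two values agree under [e], so the bound known for the extended prefix passes to
    the extended [d]. *)
Lemma absorb_trail w d : {subset trail (1 : Q) d <= trail (1 : Q) w} ->
  value M w * (value M w)^-1 * (value M d * (value M d)^-1) =
  value M w * (value M w)^-1.
Proof.
set e := value M w * _; have ee : e * e = e by apply: (idem_mulgV Mi).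
elim/last_ind: d => [|d x IHd] sub; first by rewrite value_nil invg1 !mulg1.
have {}IHd : e * (value M d * (value M d)^-1) = e.
  by apply: IHd => f fd; apply: sub; rewrite -cats1 trail_cat mem_cat fd.
have : medge (gval Q d) x \in trail 1 w.
  by apply: sub; rewrite -cats1 trail_cat mem_cat mul1g mem_head orbT.
rewrite -cats1 value_cat value_seq1.
case/trail_mem=> c [y [t [wE []]]]; rewrite mul1g => -[dE xE].
  have ec : e * (value M c * (value M c)^-1) = e by rewrite /e wE absorb_prefix.
  apply: (absorb_transfer Mi ee (absorb_eq Mi ec IHd (extends_idem (esym dE)))).
  by rewrite -value_seq1 -value_cat xE /e wE -cat_rcons -cats1 absorb_prefix.
(* Here [w] traverses the edge in the opposite direction; going back along [y] costs nothing, as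
   [y y^-1 y = y]. *)
have ec : e * (value M (rcons c y) * (value M (rcons c y))^-1) = e.
  by rewrite /e wE -cat_rcons absorb_prefix.
apply: (absorb_transfer Mi ee (absorb_eq Mi ec IHd (extends_idem (esym dE)))).
rewrite -[RHS]ec -cats1 value_cat value_seq1 xE letter_value_linv.
have YYY z : letter_value M y * ((letter_value M y)^-1 * (letter_value M y * z))
  = letter_value M y * z by rewrite !mulgA (inverse_mulgVg Mi).
by rewrite !invgM invgK -!mulgA YYY.
Qed.

(** With [e] the value of [w w^-1], [absorb_eq] gives that [e] times the value of [w'] is [e] times
    that of [w]. *)
Lemma value_below w w' : below Q w' w ->
  value M (w ++ winv w ++ w') = value M w.
Proof.
case/belowP=> w'w sub; rewrite !value_cat value_winv mulgA.
rewrite (absorb_eq Mi _ (absorb_trail sub) (extends_idem (esym w'w))).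
  by rewrite (inverse_mulgVg Mi).
exact: absorb_trail.
Qed.

End Extends.

(** * Commuting labellings and vertex potentials *)

Section Walks.
Variable E : graph.
Implicit Types (x y z : vertex E) (e : edge E) (p q : seq (edge E)).

Fixpoint walk x p y : bool :=
  if p is e :: p' then (source e == x) && walk (target e) p' y else x == y.

Lemma walk_cat x p y q z : walk x p y -> walk y q z -> walk x (p ++ q) z.
Proof.
by elim: p x => [|e p IHp] x /= => [/eqP->|/andP[-> /IHp IH] /IH].
Qed.

Lemma walk_rev x p y : walk x p y -> walk y (rev [seq einv e | e <- p]) x.
Proof.
elim: p x => [|e p IHp] x /=; first by rewrite eq_sym.
case/andP=> /eqP <- /IHp; rewrite rev_cons -cats1 => /walk_cat; apply.
by rewrite /= -target_source eqxx -source_target eqxx.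
Qed.

Lemma closed_walkE e p : closed_path (e :: p) = walk (target e) p (source e).
Proof.
rewrite /closed_path /=.
suff key g : path (fun e f : edge E => target e == source f) g (rcons p e) =
  walk (target g) p (source e) by apply: key.
by elim: p g => [|f p IHp] g /=; rewrite ?andbT // IHp eq_sym.
Qed.

Lemma walk_closed x p : walk x p x -> closed_path p.
Proof. by case: p => // e p /andP[/eqP<-]; rewrite closed_walkE. Qed.

Definition adjacent x y := [exists e, (source e == x) && (target e == y)].

Lemma connect_walk x y : connect adjacent x y -> exists p, walk x p y.
Proof.
case/connectP=> q + ->; elim: q x => [|z q IHq] x /=.
  by exists [::] => /=.
case/andP=> /existsP[e /andP[sx /eqP tz]] /IHq[p pw].
by exists (e :: p); rewrite /= sx tz.
Qed.

Lemma adjacent_sym : connect_sym adjacent.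
Proof.
apply: sym_connect_sym => x y; rewrite /adjacent; apply/existsP/existsP.
  case=> e /andP[xe ye]; exists (einv e).
  by rewrite -target_source -source_target xe ye.
case=> e /andP[xe ye]; exists (einv e).
by rewrite -target_source -source_target xe ye.
Qed.

Lemma basepoint_walks : exists (base : vertex E -> vertex E)
    (p : vertex E -> seq (edge E)),
  (forall x, walk (base x) (p x) x) /\
  (forall e, base (source e) = base (target e)).
Proof.
have /choice[p pP] x : exists p, walk (root adjacent x) p x.
  by apply: connect_walk; rewrite adjacent_sym connect_root.
exists (root adjacent), p; split=> // e.
by apply/(rootP adjacent_sym)/connect1/existsP; exists e; rewrite !eqxx.
Qed.

End Walks.

Section Potentials.
Variables (A : finType) (E : graph) (G : agroup A) (v : labelling A E).

Lemma flatten_label_rev p :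
  flatten [seq v e | e <- rev [seq einv e | e <- p]] =
  winv (flatten [seq v e | e <- p]).
Proof.
elim: p => //= e p IHp.
by rewrite rev_cons -cats1 map_cat flatten_cat IHp winv_cat /= cats0 label_inv.
Qed.

(** The potential of a vertex is the label of a chosen walk from the base point of its component. *)
Lemma commutes_potential : commutes G v -> exists h : vertex E -> word A,
  forall e, gval G (h (source e) ++ v e) = gval G (h (target e)).
Proof.
move=> vG; have [base [p [pP baseE]]] := basepoint_walks E.
exists (fun x => flatten [seq v e | e <- p x]) => e.
apply: divg1_eq; rewrite -gval_winv -flatten_label_rev -gval_cat -catA.
have : closed_path (p (source e) ++ e :: rev [seq einv e | e <- p (target e)]).
  apply: walk_closed (base (source e)) _ _; apply: walk_cat (pP _) _.
  by rewrite /= eqxx baseE; apply: walk_rev.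
by move/vG; rewrite map_cat flatten_cat /=.
Qed.

Lemma potential_commutes (h : vertex E -> word A) :
  (forall e, gval G (h (source e) ++ v e) = gval G (h (target e))) ->
  commutes G v.
Proof.
move=> hP [|e p] ep; first exact: value_nil.
have walkP q x y : walk x q y ->
    gval G (h x ++ flatten [seq v e | e <- q]) = gval G (h y).
  elim: q x => [|f q IHq] x /=; first by move=> /eqP->; rewrite cats0.
  by case/andP=> /eqP<- /IHq <-; rewrite catA !gval_cat -hP gval_cat.
have /walkP : walk (source e) (e :: p) (source e).
  by rewrite /= eqxx -closed_walkE.
by rewrite gval_cat -[RHS]mulg1 => /mulgI.
Qed.

End Potentials.

(** * Sufficiency for Ash's Theorem *)

Lemma iterated_Ab_nseq (A : finType) n m (Q : agroup A) :
  iterated_Ab (nseq n m) Q = iter n (Ab m) Q.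
Proof.
by elim: n Q => //= n IHn Q; rewrite /iterated_Ab /= [LHS]IHn -iterSr.
Qed.

Lemma solk_sufficient_for_Ash : sufficient_for_Ash solk.
Proof.
move=> A _ M _ Q _ QM E.
(* [potential_lift] takes [#|vertex E|.+1] levels per edge; one more level keeps the list of
   expansions non-empty for a graph without edges. *)
pose n := (#|edge E| * #|vertex E|.+1)%N; exists (iter n.+1 (Ab 2) Q); split.
  exists (nseq n.+1 2); rewrite iterated_Ab_nseq size_nseq; split=> //.
  by rewrite all_nseq orbT.
move=> v /commutes_potential[h hP].
pose L := [seq (source e, v e, target e) | e <- enum (edge E)].
have [c|f _ fL] := @potential_lift _ _ L Q h.
  by case/mapP=> e _ -> /=; rewrite size_map -cardE; apply: gval_Ab_eq (hP e).
have /choice[w wP] e : exists w, below Q w (v e) /\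
    freely_equal (f (source e) ++ w) (f (target e)).
  have [|w] := fL (source e, v e, target e); last by exists w.
  by apply: map_f; rewrite mem_enum.
pose u0 e := v e ++ winv (v e) ++ w e.
(* The words chosen for [e] and [einv e] need not be mutually inverse, so one edge of each pair
   determines the label of both. *)
pose u e := if (enum_rank e < enum_rank (einv e))%N then u0 e
            else winv (u0 (einv e)).
have u_inv e : u (einv e) = winv (u e).
  rewrite /u einvK.
  case: ltngtP => [_|//|/ord_inj/enum_rank_inj/esym/einv_neq//].
  by rewrite winvK.
have u0M e : value M (u0 e) = value M (v e).
  by rewrite /u0 (value_below QM) //; have [] := wP e.
have u0F e : gval (free_group A) (f (source e) ++ u0 e) =
    gval (free_group A) (f (target e)).
  have [_ /freely_gval <-] := wP e.
  by rewrite /u0 !gval_cat gval_winv mulVKg.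
exists (Labelling u_inv); split=> [e|].
  rewrite /= /u; case: ifP => // _.
  by rewrite value_winv u0M label_inv value_winv invgK.
apply: (potential_commutes (h := f)) => e; rewrite /= /u; case: ifP => // _.
have := u0F (einv e); rewrite -target_source -source_target gval_cat.
by rewrite [in X in _ -> X]gval_cat gval_winv => <-; rewrite mulgK.
Qed.

(** * Exponent sums in iterated expansions *)

Section ExponentSum.
Variable A : finType.
Implicit Types (a : A) (x : letter A) (u v w : word A).

Definition lsign x : int := (if x.2 then -1 else 1)%R.
Definition expsum a w : int := (\sum_(x <- w | x.1 == a) lsign x)%R.

Lemma expsum_cat a u v : expsum a (u ++ v) = (expsum a u + expsum a v)%R.
Proof. exact: big_cat. Qed.

Lemma expsum_freely a u v : freely_equal u v -> expsum a u = expsum a v.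
Proof.
elim=> // [? ? ? _ -> _ -> //|u1 x v1].
rewrite !expsum_cat; congr (_ + _)%R; rewrite /expsum !big_cons /=.
case: eqP => // _; rewrite addrA /lsign /=.
by case: x.2 => /=; rewrite ?addNr ?subrr add0r.
Qed.

Lemma expsum_winv a w : expsum a (winv w) = (- expsum a w)%R.
Proof.
apply/eqP; rewrite -addr_eq0 -expsum_cat; apply/eqP.
by rewrite (expsum_freely a (freely_winvl w)) /expsum big_nil.
Qed.

Lemma expsum_nseq a n b :
  expsum a (nseq n (b, false)) = Posz (if b == a then n else 0).
Proof.
elim: n => [|n IHn]; first by rewrite /expsum big_nil if_same.
rewrite /expsum big_cons -/(expsum a _) IHn /=; case: eqP => // _.
Qed.

Definition free_expsum a (f : free_group A) : int :=
  expsum a (repr (f : free_group_type A)).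

Lemma free_expsum_fword a w : free_expsum a (fword w) = expsum a w.
Proof. exact/expsum_freely/freely_repr. Qed.

Lemma free_expsumM a (f g : free_group A) :
  free_expsum a (f * g) = (free_expsum a f + free_expsum a g)%R.
Proof.
rewrite -(fword_repr f) -(fword_repr g) -[_ * _]fword_cat.
by rewrite !free_expsum_fword expsum_cat.
Qed.

Lemma free_expsumV a (f : free_group A) :
  free_expsum a f^-1 = (- free_expsum a f)%R.
Proof.
by rewrite -(fword_repr f) -[_^-1]fword_winv !free_expsum_fword expsum_winv.
Qed.

Lemma free_expsumX a (f : free_group A) n :
  free_expsum a (f ^+ n) = (free_expsum a f *+ n)%R.
Proof.
elim: n => [|n IHn].
  rewrite expg0 mulr0n -[1]/(fword [::]) free_expsum_fword.
  by rewrite /expsum big_nil.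
by rewrite expgS free_expsumM IHn mulrS.
Qed.

(** Exponent sums vanish on commutators and are multiplied by [m] on m-th powers of kernel
    elements. *)
Lemma Ab_expsum a (R : agroup A) (k m : nat) :
  (forall w, gval R w = 1 -> (k %| expsum a w)%Z) ->
  forall w, gval (Ab m R) w = 1 -> ((k * m)%N %| expsum a w)%Z.
Proof.
move=> kR w /Ab_gval1[x Cx [y Py xy]].
pose S := [set f : free_group A | ((k * m)%N %| free_expsum a f)%Z]%classic.
have SC : inverse_submonoid S.
  split=> [|f g Sf Sg|f Sf]; rewrite /S /=.
  - by rewrite -[1]/(fword [::]) free_expsum_fword /expsum big_nil dvdz0.
  - by rewrite free_expsumM rpredD.
  - by rewrite free_expsumV rpredN.
suff : S (fword w) by rewrite /S /= free_expsum_fword.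
rewrite -xy; have [_ SM _] := SC; apply: SM.
  apply: (smallest_sub SC _ Cx) => _ [u Ku [v Kv <-]].
  rewrite /S /= /commg /conjg !free_expsumM !free_expsumV.
  by rewrite (addrC (free_expsum a u)) addKr addNr dvdz0.
apply: (smallest_sub SC _ Py) => _ [u Ku <-].
rewrite /S /= free_expsumX PoszM -mulr_natr natz dvdz_mul ?dvdzz //.
exact: kR Ku.
Qed.

Lemma iterated_Ab_expsum a ms (Q : agroup A) w :
  gval (iterated_Ab ms Q) w = 1 -> ((\prod_(m <- ms) m)%N %| expsum a w)%Z.
Proof.
elim/last_ind: ms w => [|ms m IHms] w; first by rewrite big_nil dvd1z.
by rewrite /iterated_Ab foldl_rcons big_rcons /=; apply: Ab_expsum.
Qed.

Lemma gval_nseq (G : agroup A) x n : gval G (nseq n x) = glet G x ^+ n.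
Proof.
by elim: n => [|n IHn] /=; rewrite ?gval_nil ?expg0 // gval_cons IHn expgS.
Qed.

(** A power of [x] trivial at one level lies in the kernel of the next expansion, which has exponent
    [m]. *)
Lemma iterated_Ab_exponent ms (Q : agroup A) x : glet Q x = 1 ->
  gval (iterated_Ab ms Q) (nseq (\prod_(m <- ms) m) x) = 1.
Proof.
move=> x1; elim/last_ind: ms => [|ms m IHms].
  by rewrite big_nil /= gval_cons gval_nil mulg1.
rewrite /iterated_Ab foldl_rcons big_rcons /=.
rewrite gval_nseq expgnA -gval_nseq; apply: Ab_ker_exp.
by rewrite gval_Ab_proj.
Qed.

End ExponentSum.

(** * Alternating products in the free group on two letters *)

Section HeisenbergAction.
Implicit Types (w : word bool) (s : int * int).

(* Right multiplication in the integral Heisenberg group, with the coordinate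
   that no other coordinate depends on left out; false and true act as the two
   generators. *)
Definition heis s (x : letter bool) : int * int :=
  if x.1 then (s.1, s.2 + lsign x * s.1)%R else (s.1 + lsign x, s.2)%R.

Lemma heis_freely s u v : freely_equal u v -> foldl heis s u = foldl heis s v.
Proof.
elim=> [//|? ? _ -> //|? ? ? _ -> _ -> //|u1 x v1].
rewrite !foldl_cat /=; congr foldl; case: (foldl _ _ _) => p r.
by case: x => -[] []; rewrite /heis /lsign /=; congr (_, _); ring.
Qed.

Lemma heis_content (b : bool) w s : all (fun x => x.1 == b) w ->
  foldl heis s w = (if b then (s.1, s.2 + expsum b w * s.1)%R
                    else (s.1 + expsum b w, s.2)%R).
Proof.
elim: w s => [|x w IHw] [p r] /=.
  by rewrite /expsum big_nil mul0r !addr0; case: b.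
case/andP=> xb /IHw ->; rewrite /expsum big_cons xb /heis (eqP xb).
by case: b {xb IHw}; congr (_, _); rewrite /=; ring.
Qed.

(** With exponent sums i, j, k, l the product moves (0, 0) to (i + k, ji + l(i + k)); if this is (0,
    0), then ji = 0. *)
Lemma alternating_product_neq1 w1 w2 w3 w4 :
    all (fun x => x.1 == false) w1 -> all (fun x => x.1 == true) w2 ->
    all (fun x => x.1 == false) w3 -> all (fun x => x.1 == true) w4 ->
    freely_equal (w1 ++ w2 ++ w3 ++ w4) [::] ->
  expsum false w1 = 0%R \/ expsum true w2 = 0%R.
Proof.
move=> c1 c2 c3 c4 /(heis_freely (0, 0)%R).
rewrite !foldl_cat (heis_content _ c1) (heis_content _ c2) /=.
rewrite (heis_content _ c3) (heis_content _ c4) /= => -[-> /eqP].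
rewrite mulr0 addr0 !add0r mulf_eq0 => /orP[]/eqP->; by [left|right].
Qed.

End HeisenbergAction.

(** * The semilattice, the trivial group and the labelled 4-cycle *)

Definition content : Type := {set bool}.
HB.instance Definition _ := Choice.on content.
Fact content_invM : {morph (@id content) : x y / x :|: y >-> y :|: x}.
Proof. by move=> x y; rewrite finset.setUC. Qed.
HB.instance Definition _ := isStarMonoid.Build content (@finset.setUA bool)
  (@finset.set0U bool) (fun=> erefl) content_invM.

Lemma content_inverse : inverse_monoid content.
Proof.
move=> x y; split=> [[xyx yxy]|->].
  rewrite -[RHS]xyx -[LHS]yxy; rewrite /mul /=.
  by apply/setP=> a; rewrite !finset.inE; do 2 case: (a \in _).
by split; rewrite /mul /= !finset.setUid.
Qed.

Definition content_gen (a : bool) : content := [set a]%SET.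

Lemma content_generates : generates content_gen.
Proof.
rewrite /generates -subTset => X _ S [[S1 SM _] genS].
have Sa a : S (content_gen a) by apply: genS; exists a.
have -> : X =
    (if true \in (X : {set bool}) then content_gen true else finset.set0) *
    (if false \in (X : {set bool}) then content_gen false else finset.set0).
  apply/setP=> a; rewrite [RHS]finset.inE.
  by case Xt: (true \in _); case Xf: (false \in _); case: a;
    rewrite ?Xt ?Xf ?finset.inE.
by apply: SM; case: ifP.
Qed.

Definition content_monoid : invmonoid bool :=
  InvMonoid content_inverse content_generates.

Lemma value_content (w : word bool) a :
  (a \in (value content_monoid w : {set bool})) = (a \in [seq x.1 | x <- w]).
Proof.
elim: w => [|x w IHw]; first by rewrite value_nil finset.inE.
rewrite -cat1s value_cat value_seq1 map_cat mem_cat -IHw [LHS]finset.inE.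
by congr (_ || _); rewrite /letter_value if_same !inE.
Qed.

Definition trivial_carrier : Type := unit.
HB.instance Definition _ := Choice.on trivial_carrier.
Definition trivial_op (x y : trivial_carrier) : trivial_carrier := tt.
Fact trivial_opA : associative trivial_op. Proof. by []. Qed.
Fact trivial_op1 : left_id tt trivial_op. Proof. by case. Qed.
Fact trivial_opr1 : right_id tt trivial_op. Proof. by case. Qed.
Fact trivial_opV : left_inverse tt id trivial_op. Proof. by []. Qed.
Fact trivial_oprV : right_inverse tt id trivial_op. Proof. by []. Qed.
HB.instance Definition _ := isGroup.Build trivial_carrier
  trivial_opA trivial_op1 trivial_opr1 trivial_opV trivial_oprV.

Lemma trivial_generates : generates (fun _ : bool => tt : trivial_carrier).
Proof. by rewrite /generates -subTset => -[] _ S [[]]. Qed.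

Definition trivial_group : agroup bool := AGroup trivial_generates.

Section Square.

Let flip (e : (bool * bool) * bool) : bool * bool :=
  if e.2 then (e.1.1, ~~ e.1.2) else (~~ e.1.1, e.1.2).
Let coord (e : (bool * bool) * bool) : bool := if e.2 then e.1.2 else e.1.1.

Fact square_einvK : involutive (fun e => (flip e, e.2)).
Proof. by case=> [[[] []] []]. Qed.

Fact square_source_target e : e.1 = flip (flip e, e.2).
Proof. by case: e => [[[] []] []]. Qed.

Fact square_einv_neq e : e <> (flip e, e.2).
Proof. by case: e => [[[] []] []]. Qed.

(* The 4-cycle, as the Cayley graph of (Z/2)^2: the edge (x, d) flips the
   coordinate d of x. *)
Definition square : graph :=
  Graph square_einvK square_source_target (fun=> erefl) square_einv_neq.

Lemma square_connected : connected square.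
Proof.
have step x d : connect (fun x y => [exists e : edge square,
    (source e == x) && (target e == y)]) x (flip (x, d)).
  by apply/connect1/existsP; exists (x, d); rewrite !eqxx.
move=> x y; apply: (@connect_trans _ _ (y.1, x.2)).
  case: (eqVneq x.1 y.1) => [<-|xy]; first by rewrite -surjective_pairing.
  by have := step x false; rewrite /flip /=; case: x y xy => [[] ?] [[] ?].
case: (eqVneq x.2 y.2) => [->|xy]; first by rewrite -surjective_pairing.
have := step (y.1, x.2) true; rewrite /flip /=.
by case: x y xy => [? []] [? []].
Qed.

(** With [false] for a and [true] for b, raising the first coordinate reads a^n and raising the
    second reads b^n; lowering reads the inverse. *)
Definition square_label (n : nat) (e : edge square) : word bool :=
  let w := nseq n (e.2, false) in if coord e then winv w else w.

Fact square_label_inv n e : square_label n (einv e) = winv (square_label n e).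
Proof. by case: e => [[[] []] []]; rewrite /square_label /= ?winvK. Qed.

Lemma square_label_content n e : all (fun x => x.1 == e.2) (square_label n e).
Proof.
rewrite /square_label.
by case: ifP => _; rewrite ?all_rev ?all_map all_nseq /= eqxx orbT.
Qed.

Lemma expsum_square_label n e : `|expsum e.2 (square_label n e)|%N = n.
Proof.
rewrite /square_label; case: ifP => _; rewrite ?expsum_winv ?abszN;
  by rewrite expsum_nseq eqxx.
Qed.

Definition square_labelling n : labelling bool square :=
  Labelling (@square_label_inv n).

Definition square_potential n (x : vertex square) : word bool :=
  (if x.1 then nseq n (false, false) else [::]) ++
  (if x.2 then nseq n (true, false) else [::]).

Lemma square_commutes (G : agroup bool) n :
    commute (gval G (nseq n (false, false))) (gval G (nseq n (true, false))) ->
  commutes G (square_labelling n).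
Proof.
move=> comm.
apply: (potential_commutes (h := square_potential n)) => -[[x y] d].
rewrite /= /square_label /square_potential !gval_cat.
case: x; case: y; case: d => /=;
  rewrite ?gval_winv ?gval_nil ?mulg1 ?mul1g ?mulgK ?mulgV //.
by rewrite comm mulgK.
Qed.

End Square.

(** * Failure of the strengthened Ash Theorem *)

Lemma solk_not_sufficient_for_strengthened_Ash :
  ~ sufficient_for_strengthened_Ash solk.
Proof.
move=> strong.
have cardb : (0 < #|{: bool}|)%N by rewrite card_bool.
have Mfin : is_finite content_monoid by exact: (@finite_finset {set bool}).
have Qfin : is_finite trivial_group by exact: (@finite_finset unit).
have QM : extends trivial_group content_monoid.
  by move=> w _; apply: finset.setUid.
have [H [[ms [ms0 ms2 HE]] HP]] := strong _ cardb _ Mfin _ Qfin QM 4 isT.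
case/lastP: ms ms0 ms2 HE => // ms m _; rewrite all_rcons => /andP[m2 ms2].
(* The last factor [m] is left out: this puts a^n and b^n into the last kernel, while [n] is not
   divisible by [n * m]. *)
pose n := (\prod_(k <- ms) k)%N; rewrite /iterated_Ab foldl_rcons => HE.
have n0 : (0 < n)%N.
  by rewrite /n big_seq; apply: prodn_cond_gt0 => k /(allP ms2)/ltnW.
have kerP x :
    Ab_proj (gval (Ab m (iterated_Ab ms trivial_group)) (nseq n x)) = 1.
  by rewrite gval_Ab_proj iterated_Ab_exponent //; case: (glet _ _).
have vH : commutes H (square_labelling n).
  by rewrite HE; apply: square_commutes; apply: Ab_ker_comm.
have [|u [uM uH uF]] := HP square square_connected _ _ vH.
  by rewrite card_prod !card_bool.
have uC e : all (fun x => x.1 == e.2) (u e).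
  apply/allP=> x xu; have : x.1 \in (value content_monoid (u e) : {set bool}).
    by rewrite value_content map_f.
  rewrite uM value_content => /mapP[y yl ->].
  exact: (allP (square_label_content n e)).
(* Otherwise [winv (u e) ++ square_label n e] would be trivial in [H] with an exponent sum of
   absolute value [n]. *)
have uE e : expsum e.2 (u e) <> 0%R.
  move=> u0; have := @iterated_Ab_expsum _ e.2 (rcons ms m) trivial_group
    (winv (u e) ++ square_label n e).
  rewrite /iterated_Ab foldl_rcons -HE gval_cat gval_winv.
  have -> : gval H (u e) = gval H (square_label n e) := uH e.
  rewrite mulVg expsum_cat expsum_winv u0 oppr0 add0r => /(_ erefl).
  rewrite dvdzE expsum_square_label big_rcons /= => /(dvdn_leq n0).
  by rewrite leqNgt ltn_Pmulr.
have /freely_gval : gval (free_group bool) (flatten [seq u e | e <-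
    [:: (false, false, false); (true, false, true);
        (true, true, false); (false, true, true)]]) =
    gval (free_group bool) [::] by rewrite gval_nil; apply: uF.
rewrite /= cats0 => /alternating_product_neq1 [].
- exact: (uC (false, false, false)).
- exact: (uC (true, false, true)).
- exact: (uC (true, true, false)).
- exact: (uC (false, true, true)).
- exact: (uE (false, false, false)).
- exact: (uE (true, false, true)).
Qed.

Theorem theorem5p4 :
  sufficient_for_Ash solk /\ ~ sufficient_for_strengthened_Ash solk.
Proof.
exact: conj solk_sufficient_for_Ash solk_not_sufficient_for_strengthened_Ash.
Qed.
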